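(* Let $p,q\ge1$ be integers. Let $(U_t)_{t\in\mathbb{Z}}$ be a sequence of i.i.d. integrable random vectors in $\mathbb{N}^p$, independent of a family $$\left\{Y_s^{t,j,i,\ell}:(s,t,j,i,\ell)\in\mathbb{Z}^2\times\{1,\dots,q\}\times\{1,\dots,p\}^2\right\}$$ of independent, integrable, $\mathbb{N}$-valued random variables such that, for all $(j,i,\ell)\in\{1,\dots,q\}\times\{1,\dots,p\}^2$, the variables $Y_s^{t,j,i,\ell}$, $(s,t)\in\mathbb{Z}^2$, all have the same distribution, with mean $A_j(i,\ell)$. Let $A_j=(A_j(i,\ell))_{1\le i,\ell\le p}$ for $j=1,\dots,q$. Consider the recursions $$X_t=\sum_{j=1}^qA_{t,j}\circ X_{t-j}+U_t,\qquad t\in\mathbb{Z},\qquad(\ast)$$ where for $x\in\mathbb{N}^p$, $$A_{t,j}\circ x=\left(\sum_{\ell=1}^pA_{t,j}(i,\ell)\circ x_\ell\right)_{1\le i\le p},\qquad A_{t,j}(i,\ell)\circ y=\sum_{s=1}^yY_s^{t,j,i,\ell}\quad (y\in\mathbb{N}).$$ Assume that the spectral radius of $A_1+\cdots+A_q$ is less than $1$. Then there exists a unique stationary, non-anticipative and integrable solution $(X_t)_{t\in\mathbb{Z}}$ of $(\ast)$. If in addition there exists $r>1$ such that, for all $(j,i,\ell)\in\{1,\dots,q\}\times\{1,\dots,p\}^2$, $Y_0^{0,j,i,\ell}$ and $U_0$ have a finite moment of order $r$, then $\mathbb{E}|X_0|_1^r<\infty$.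
   Context: $\mathbb{N}=\{0,1,2,\dots\}$ and $|x|_1=\sum_{i=1}^p|x_i|$ for $x\in\mathbb{R}^p$. Solutions take values in $\mathbb{N}^p$. Let $\epsilon_t$ be the collection consisting of $U_t$ and all $Y_s^{t,j,i,\ell}$, $s\in\mathbb{Z}$, $1\le j\le q$, $1\le i,\ell\le p$. A process $(X_t)_{t\in\mathbb{Z}}$ is non-anticipative if $X_t$ is measurable with respect to $\sigma(\epsilon_s:s\le t)$ for every $t$. Integrable means $\mathbb{E}|X_t|_1<\infty$; uniqueness is up to almost sure equality. *)

(* Defs.v *)
From HB Require Import structures.
From mathcomp Require Import all_boot all_order all_algebra finmap.
From mathcomp Require Import all_classical all_reals all_analysis.
From mathcomp Require Import complex.

Set Implicit Arguments.
Unset Strict Implicit.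
Unset Printing Implicit Defensive.

Import Order.TTheory GRing.Theory Num.Theory.
Local Open Scope classical_set_scope.
Local Open Scope ring_scope.

(* As N^p is countable, the product of p copies of the discrete sigma-algebra
   of nat is the discrete sigma-algebra. *)
HB.instance Definition _ (p : nat) := @isMeasurable.Build
  default_measure_display 'cV[nat]_p discrete_measurable discrete_measurable0
  discrete_measurableC discrete_measurableU.

Definition norm1 (p : nat) (x : 'cV[nat]_p) : nat := (\sum_(i < p) x i ord0)%N.

(* The set of eigenvalues is finite, and nonempty when p > 0, so the supremum
   is a maximum. *)
Definition spectral_radius (R : realType) (p : nat) (M : 'M[R]_p) : R :=
  sup [set Normc.normc z | z in
    [set z : R[i] | eigenvalue (map_mx (real_complex R) M) z]].

Definition sigma_of (d d' : measure_display) (T : measurableType d)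
    (V : measurableType d') (X : T -> V) : set_system T :=
  preimage_set_system [set: T] X measurable.

Definition mutually_independent (d : measure_display) (T : measurableType d)
    (R : realType) (P : probability T R) (I : choiceType)
    (F : I -> set_system T) : Prop :=
  forall (J : {fset I}) (E : I -> set T), (forall i, i \in J -> F i (E i)) ->
    P (\bigcap_(i in [set` J]) E i) = (\prod_(i <- J) P (E i))%E.

Definition independent2 (d : measure_display) (T : measurableType d)
    (R : realType) (P : probability T R) (F G : set_system T) : Prop :=
  forall A B : set T, F A -> G B -> P (A `&` B) = (P A * P B)%E.

Definition integrable_vec (d : measure_display) (T : measurableType d)
    (R : realType) (P : probability T R) (p : nat) (X : T -> 'cV[nat]_p) : Prop :=
  P.-integrable [set: T] (fun w => ((norm1 (X w))%:R : R)%:E).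

Definition finite_moment (d : measure_display) (T : measurableType d)
    (R : realType) (P : probability T R) (r : R) (Z : T -> nat) : Prop :=
  ('E_P[fun w => (((Z w)%:R : R) `^ r)%R] < +oo)%E.

(* Strict stationarity: equality of the finite-dimensional laws, which live on
   the countable spaces (N^p)^n and are thus compared on all subsets. *)
Definition stationary (d : measure_display) (T : measurableType d)
    (R : realType) (P : probability T R) (p : nat)
    (X : int -> T -> 'cV[nat]_p) : Prop :=
  forall (n : nat) (t : 'I_n -> int) (h : int) (B : set ('I_n -> 'cV[nat]_p)),
    P [set w | B (fun k => X (t k + h) w)] = P [set w | B (fun k => X (t k) w)].

(* In [Y s t j i l], s and t are the lower and the upper time index; the
   ordinal j : 'I_q stands for the lag j.+1. *)
Definition innovation (d : measure_display) (T : measurableType d) (p q : nat)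
    (U : int -> T -> 'cV[nat]_p)
    (Y : int -> int -> 'I_q -> 'I_p -> 'I_p -> T -> nat) (t : int) :
    set_system T :=
  sigma_of (U t) `|`
  \bigcup_(k in [set: int * 'I_q * 'I_p * 'I_p])
    (let: (s, j, i, l) := k in sigma_of (Y s t j i l)).

Definition past (d : measure_display) (T : measurableType d) (p q : nat)
    (U : int -> T -> 'cV[nat]_p)
    (Y : int -> int -> 'I_q -> 'I_p -> 'I_p -> T -> nat) (t : int) :
    set_system T :=
  \bigcup_(s in [set s : int | s <= t]) innovation U Y s.

Definition non_anticipative (d : measure_display) (T : measurableType d)
    (p q : nat) (U : int -> T -> 'cV[nat]_p)
    (Y : int -> int -> 'I_q -> 'I_p -> 'I_p -> T -> nat)
    (X : int -> T -> 'cV[nat]_p) : Prop :=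
  forall t : int, measurable_fun
    [set: g_sigma_algebraType (past U Y t)]
    (X t : g_sigma_algebraType (past U Y t) -> 'cV[nat]_p).

Definition thinning (y : int -> nat) (n : nat) : nat :=
  (\sum_(1 <= s < n.+1) y s%:Z)%N.

Definition thinning_mx (p : nat) (y : 'I_p -> 'I_p -> int -> nat)
    (x : 'cV[nat]_p) : 'cV[nat]_p :=
  \col_(i < p) (\sum_(l < p) thinning (y i l) (x l ord0))%N.

Definition solution (d : measure_display) (T : measurableType d)
    (R : realType) (P : probability T R) (p q : nat)
    (U : int -> T -> 'cV[nat]_p)
    (Y : int -> int -> 'I_q -> 'I_p -> 'I_p -> T -> nat)
    (X : int -> T -> 'cV[nat]_p) : Prop :=
  forall t : int, {ae P, forall w, X t w =
    \sum_(j < q) thinning_mx (fun i l s => Y s t j i l w)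
                             (X (t - (j.+1)%:Z) w) + U t w}.

Definition good_solution (d : measure_display) (T : measurableType d)
    (R : realType) (P : probability T R) (p q : nat)
    (U : int -> T -> 'cV[nat]_p)
    (Y : int -> int -> 'I_q -> 'I_p -> 'I_p -> T -> nat)
    (X : int -> T -> 'cV[nat]_p) : Prop :=
  [/\ solution P U Y X, stationary P X, non_anticipative U Y X
    & forall t, integrable_vec P (X t)].

(* Main.v *)
(* Let X^(n) be the Picard iterates of the recursion started at 0; they are
   coordinatewise nondecreasing in n. As the spectral radius of A = A_1+...+A_q is
   less than 1, a truncated Neumann series gives u >= 1 with A u <= u - 1/2. The
   offspring variables at time t are independent of the past, so Wald's identity
   gives E X^(n+1)_t = sum_j A_j E X^(n)_(t-j) + E U_t, whence E X^(n) <= 2 m u with m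
   bounding E U. The limit X is therefore almost surely finite, integrable and a
   solution; being a shift-covariant functional of the noise, whose law is shift
   invariant, it is stationary.
   For two solutions, V_t = E|X_t - X'_t| satisfies V_t <= sum_j A_j V_(t-j) and is
   bounded by some c u, hence by c k^n u for all n, with k < 1: it vanishes.
   For the moment of order r, write S = X^(n+1)_(t,i) as the sum of U_(t,i) and of the
   terms Y_s 1(s <= X^(n)_(t-j,l)), and expand E S^r as the sum of the
   E[Y_s 1(s <= X^(n)_(t-j,l)) S^(r-1)], with S^(r-1) truncated to stay integrable.
   Up to a factor 1+e and lower order terms, Y_s may be removed from S^(r-1), of which
   it is then independent; Young's inequality with weights u_l/u_i then propagates
   the bound E (X^(n)_(t,i))^r <= c u_i^r from n to n+1. *)

Require Import Defs.
From HB Require Import structures.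
From mathcomp Require Import all_boot all_order all_algebra finmap.
From mathcomp Require Import all_classical all_reals all_analysis.
From mathcomp Require Import measurable_realfun complex ring lra zify.

Set Implicit Arguments.
Unset Strict Implicit.
Unset Printing Implicit Defensive.

Import Order.TTheory GRing.Theory Num.Theory.
Import numFieldNormedType.Exports.
Local Open Scope classical_set_scope.
Local Open Scope ring_scope.

(** * Matrices of spectral radius less than 1 *)

Section matrix_powers.
Variables (R : realType) (n : nat).
Implicit Types M V : 'M[R[i]]_n.+1.

Let nrm V : R := \sum_i \sum_j Normc.normc (V i j).

Let nrm_ge0 V : 0 <= nrm V.
Proof. by do 2![apply: sumr_ge0 => ? _]; case: (V _ _) => a b /=; exact: sqrtr_ge0. Qed.

Let nrmD V V' : nrm (V + V') <= nrm V + nrm V'.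
Proof.
rewrite /nrm -big_split; apply: ler_sum => i _.
rewrite -big_split; apply: ler_sum => j _; rewrite mxE; exact: le_normcD.
Qed.

Let nrmZ z V : nrm (z *: V) = Normc.normc z * nrm V.
Proof.
rewrite /nrm mulr_sumr; apply: eq_bigr => i _.
by rewrite mulr_sumr; apply: eq_bigr => j _; rewrite mxE Normc.normcM.
Qed.

(** The test matrix [V] absorbs the factors of a polynomial in [M], which can then be stripped off
    one by one. *)
Let summable M V := exists c, forall N, \sum_(k < N) nrm (M ^+ k * V) <= c.

(** From [M ^+ k.+1 * V = M ^+ k * ((M - z) * V) + z * M ^+ k * V], the partial sums [s] of the
    norms satisfy s <= nrm V + c + |z| s, which is solved for [s] as |z| < 1. *)
Let summable_factor M V z : Normc.normc z < 1 ->
  summable M ((M - z%:M) * V) -> summable M V.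
Proof.
move=> z1 [c Hc]; exists ((nrm V + c) / (1 - Normc.normc z)) => N.
rewrite ler_pdivlMr ?subr_gt0//.
set s := (X in X * _ <= _).
suff : s <= nrm V + c + Normc.normc z * s by rewrite mulrBr mulr1 [s * _]mulrC; lra.
apply: (@le_trans _ _ (\sum_(k < N.+1) nrm (M ^+ k * V))).
  by rewrite big_ord_recr/= lerDl nrm_ge0.
rewrite big_ord_recl expr0 mul1r -addrA lerD2l.
apply: (@le_trans _ _ (\sum_(k < N) (nrm (M ^+ k * ((M - z%:M) * V)) +
   Normc.normc z * nrm (M ^+ k * V)))); last first.
  by rewrite big_split/= -mulr_sumr; apply: lerD; [exact: Hc|exact: lexx].
apply: ler_sum => k _; rewrite -nrmZ; apply: le_trans (nrmD _ _).
rewrite le_eqVlt; apply/orP; left; apply/eqP; congr nrm.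
rewrite mulrBl mulrBr [z%:M * V]mul_scalar_mx.
by rewrite -scalerAr subrK mulrA -exprSr.
Qed.

(* By Cayley-Hamilton the product of the [M - z], over the eigenvalues [z], is 0;
   [summable_factor] removes its factors one at a time. *)
Lemma summable_powers M : (forall z, eigenvalue M z -> Normc.normc z < 1) ->
  exists c, forall N, \sum_(k < N) nrm (M ^+ k) <= c.
Proof.
move=> Mlt1.
have [rs Hrs] := closed_field_poly_normal (char_poly M).
rewrite (monicP (char_poly_monic M)) scale1r in Hrs.
have rs1 z : z \in rs -> Normc.normc z < 1.
  move=> zrs; apply: Mlt1; rewrite eigenvalue_root_char Hrs.
  by rewrite root_prod_XsubC.
have {Hrs} : horner_mx M (\prod_(z <- rs) ('X - z%:P)) = 0.
  by rewrite -Hrs; exact: Cayley_Hamilton.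
suff H V : summable M (horner_mx M (\prod_(z <- rs) ('X - z%:P)) * V) ->
    summable M V.
  move=> M0; have [|c Hc] := H 1.
    rewrite M0 mul0r; exists 0 => N; rewrite big1// => k _.
    rewrite mulr0 /nrm big1// => i _; rewrite big1// => j _.
    by rewrite mxE Normc.normc0.
  by exists c => N; have := Hc N; under eq_bigr do rewrite mulr1.
elim: rs rs1 V => [|z rs IH] rs1 V; first by rewrite big_nil rmorph1 mul1r.
rewrite big_cons mulrC rmorphM/= -mulrA => /IH H.
apply: (@summable_factor _ _ z); first by apply: rs1; rewrite mem_head.
move: H; rewrite rmorphB/= horner_mx_X horner_mx_C; apply => z' z'rs.
by apply: rs1; rewrite in_cons z'rs orbT.
Qed.

End matrix_powers.

(** A supremum dominates the members only of a set bounded above; here the sum of the moduli of the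
    roots of the characteristic polynomial is a bound. *)
Lemma normc_eigenvalue_lt1 (R : realType) p (A : 'M[R]_p) z :
  spectral_radius A < 1 -> eigenvalue (map_mx (real_complex R) A) z ->
  Normc.normc z < 1.
Proof.
move=> rA ez; apply: le_lt_trans rA; apply: ub_le_sup; last by exists z.
have [rs Hrs] := closed_field_poly_normal (char_poly (map_mx (real_complex R) A)).
rewrite (monicP (char_poly_monic _)) scale1r in Hrs.
exists (\sum_(z <- rs) Normc.normc z) => _ [x /= xA <-].
move: xA; rewrite eigenvalue_root_char Hrs root_prod_XsubC => xrs.
rewrite (perm_big _ (perm_to_rem xrs)) big_cons lerDl.
by apply: sumr_ge0 => -[a b] _; exact: sqrtr_ge0.
Qed.

(* The truncated Neumann series [\sum_(k < m) A ^+ k *m 1] at an [m] for which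
   [A ^+ m *m 1] is small. *)
Lemma spectral_radius_lt1_supersolution (R : realType) (p : nat) (A : 'M[R]_p) :
  (forall i l, 0 <= A i l) -> spectral_radius A < 1 ->
  exists u : 'I_p -> R, (forall i, 1 <= u i) /\
    forall i, \sum_l A i l * u l <= u i - 2^-1.
Proof.
case: p A => [|p] A A0 rA; first by exists (fun=> 1); split=> -[].
have Ak0 k i l : 0 <= (A ^+ k) i l.
  elim: k i l => [|k IH] i l; first by rewrite expr0 mxE ler0n.
  by rewrite exprS mxE sumr_ge0// => j _; rewrite mulr_ge0.
have [c Hc] := @summable_powers R p (map_mx (real_complex R) A)
  (fun z => normc_eigenvalue_lt1 rA).
pose a k := \sum_i \sum_j (A ^+ k) i j.
have {}Hc N : \sum_(k < N) a k <= c.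
  apply: le_trans (Hc N); apply: ler_sum => k _; apply: ler_sum => i _.
  apply: ler_sum => j _; rewrite -rmorphXn mxE /= expr0n addr0 sqrtr_sqr.
  exact: ler_norm.
(* Otherwise every term [a k] is at least 1/2 and the partial sums exceed the bound [c]. *)
have [m am] : exists m, a m < 2^-1.
  apply: contrapT => /forallNP H.
  suff : forall N : nat, N%:R / 2 <= c.
    move=> /(_ (Num.bound (2 * c))).
    have := Hc 0%N; rewrite big_ord0 => c0.
    have := archi_boundP (mulr_ge0 (ler0n R 2) c0); lra.
  move=> N; apply: le_trans (Hc N).
  apply: (@le_trans _ _ (\sum_(k < N) 2^-1)).
    by rewrite sumr_const card_ord mulr_natl.
  by apply: ler_sum => k _; have /negP := H k; rewrite -leNgt.
have row_le k i : \sum_j (A ^+ k) i j <= a k.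
  rewrite /a [leRHS](bigD1 i)//= lerDl sumr_ge0// => ? _; exact: sumr_ge0.
have E0 i : \sum_j (A ^+ 0) i j = 1.
  rewrite expr0 (bigD1 i)//= mxE eqxx big1 ?addr0//.
  by move=> j /negbTE; rewrite mxE eq_sym => ->.
exists (fun i => \sum_(k < m) \sum_j (A ^+ k) i j); split=> i.
  (* [m = 0] is impossible since [a 0 >= 1]; otherwise the term [k = 0] alone contributes 1 to
     [u i]. *)
  case: m am => [|m] am.
    by have := le_lt_trans (row_le 0%N ord0) am; rewrite E0; lra.
  rewrite big_ord_recl E0 lerDl.
  by do 2![apply: sumr_ge0 => ? _].
have -> : \sum_l A i l * (\sum_(k < m) \sum_j (A ^+ k) l j) =
    \sum_(k < m) \sum_j (A ^+ k.+1) i j.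
  under eq_bigr do rewrite mulr_sumr; rewrite exchange_big/=.
  apply: eq_bigr => k _.
  under eq_bigr do rewrite mulr_sumr; rewrite exchange_big/=.
  by apply: eq_bigr => j _; rewrite exprS mxE.
(* Splitting this sum at its first and at its last term gives A u = u - 1 + A^m 1, where the last
   term is below 1/2. *)
have : \sum_(k < m.+1) \sum_j (A ^+ k) i j =
    \sum_j (A ^+ 0) i j + \sum_(k < m) \sum_j (A ^+ k.+1) i j.
  by rewrite big_ord_recl.
rewrite big_ord_recr/= E0.
have := le_lt_trans (row_le m i) am; lra.
Qed.

(** * Discrete random variables *)

Lemma bigcup_countType_measurable d (T : measurableType d) (A : countType)
    (D : set A) (F : A -> set T) :
  (forall a, D a -> measurable (F a)) -> measurable (\bigcup_(a in D) F a).
Proof.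
move=> mF; rewrite bigcup_mkcond; apply: countable_bigcupT_measurable.
  exact: countableP.
by move=> a; case: ifPn => // /set_mem; exact: mF.
Qed.

Section discrete_measurability.
Context {d : measure_display} {T : measurableType d}.

(* Measurability for the discrete sigma-algebra on [A], whether or not [A] carries
   a measurable structure. *)
Definition dmeas (A : Type) (f : T -> A) := forall B : set A, measurable (f @^-1` B).

Lemma dmeas_singleton (A : countType) (f : T -> A) :
  (forall a, measurable (f @^-1` [set a])) -> dmeas f.
Proof.
move=> mf B; rewrite [X in measurable X](_ : _ = \bigcup_(a in B) f @^-1` [set a]).
  by apply: bigcup_countType_measurable.
by apply/seteqP; split=> [w Bw|w [a Ba /= ->]//]; exists (f w).
Qed.

Lemma dmeas_cst (A : Type) (a : A) : dmeas (fun=> a).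
Proof. by move=> B; rewrite preimage_cst; case: ifP. Qed.

Lemma dmeas_map (A A' : Type) (h : A -> A') (f : T -> A) :
  dmeas f -> dmeas (fun w => h (f w)).
Proof. by move=> mf B; exact: (mf (h @^-1` B)). Qed.

(** The preimage splits along the countably many values of [f]; a random parameter, such as a number
    of summands, may thus be treated as a constant. *)
Lemma dmeas_bind (A : countType) (A' : Type) (f : T -> A) (g : A -> T -> A') :
  dmeas f -> (forall a, dmeas (g a)) -> dmeas (fun w => g (f w) w).
Proof.
move=> mf mg B; rewrite [X in measurable X](_ : _ =
    \bigcup_(a in [set: A]) (f @^-1` [set a] `&` g a @^-1` B)).
  apply: bigcup_countType_measurable => a _.
  by apply: measurableI; [exact: mf|exact: mg].
by apply/seteqP; split=> [w Bw|w [a _ [/= <-]]//]; exists (f w).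
Qed.

Lemma dmeas_pair (A A' : countType) (f : T -> A) (g : T -> A') :
  dmeas f -> dmeas g -> dmeas (fun w => (f w, g w)).
Proof.
by move=> mf mg; apply: (dmeas_bind mf (g := fun a w => (a, g w))) => a; exact: dmeas_map.
Qed.

Lemma dmeas_big (A : countType) (op : A -> A -> A) (idx : A) (I : Type)
    (r : seq I) (Q : pred I) (F : I -> T -> A) :
  (forall i, dmeas (F i)) -> dmeas (fun w => \big[op/idx]_(i <- r | Q i) F i w).
Proof.
move=> mF; elim: r => [|i r IH].
  rewrite (_ : (fun _ => _) = fun=> idx); first exact: dmeas_cst.
  by apply/funext => w; rewrite big_nil.
rewrite (_ : (fun _ => _) = fun w =>
    let x := \big[op/idx]_(j <- r | Q j) F j w in if Q i then op (F i w) x else x).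
  case: (Q i) => //.
  apply: (dmeas_bind (mF i) (g := fun a w => op a _)) => a.
  exact: (dmeas_map (op a)).
by apply/funext => w; rewrite big_cons.
Qed.

Lemma dmeas_col (p : nat) (F : 'I_p -> T -> nat) :
  (forall i, dmeas (F i)) -> dmeas (fun w => \col_i F i w : 'cV[nat]_p).
Proof.
move=> mF; apply: (@dmeas_singleton 'cV[nat]_p) => v.
rewrite [X in measurable X](_ : _ =
    \bigcap_(i in [set: 'I_p]) F i @^-1` [set v i ord0]).
  by apply: fin_bigcap_measurable => // i _; exact: mF.
apply/seteqP; split=> [w /= <- i _ /=|w Hw /=]; first by rewrite mxE.
by apply/colP => i; rewrite mxE; exact: Hw.
Qed.

Lemma dmeas_thinning (y : int -> T -> nat) (N : T -> nat) :
  (forall s, dmeas (y s)) -> dmeas N -> dmeas (fun w => thinning (y ^~ w) (N w)).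
Proof.
move=> my mN; apply: (dmeas_bind (f := N) (g := fun n w => thinning (y ^~ w) n)) => // n.
exact: dmeas_big.
Qed.

(** Having [a] as eventual value is a countable union over [N] of countable intersections over [n].
    The default [a0] covers the points without an eventual value. *)
Lemma dmeas_eventually (A : countType) (a0 : A) (f : nat -> T -> A) :
  (forall n, dmeas (f n)) ->
  dmeas (fun w => xget a0 [set a | exists N, forall n, (N <= n)%N -> f n w = a]).
Proof.
move=> mf.
pose L a := [set w | exists N, forall n, (N <= n)%N -> f n w = a].
have mL a : measurable (L a).
  rewrite (_ : L a = \bigcup_N \bigcap_n
      (if (N <= n)%N then f n @^-1` [set a] else setT)).
    apply: bigcup_measurable => N _; apply: bigcapT_measurable => n.
    by case: ifP => // _; exact: mf.
  apply/seteqP; split=> w /=.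
    by move=> [N HN]; exists N => // n _; case: ifP => // /HN.
  by move=> [N _ HN]; exists N => n Nn; have := HN n I; rewrite Nn.
have uL a b w : L a w -> L b w -> a = b.
  move=> [N HN] [M HM]; rewrite -(HN (maxn N M)) ?leq_maxl//.
  by rewrite -(HM (maxn N M)) ?leq_maxr.
apply: dmeas_singleton => a.
rewrite [X in measurable X](_ : _ =
  L a `|` (if a == a0 then ~` \bigcup_(b in [set: A]) L b else set0)).
  apply: measurableU => //; case: ifP => // _; apply: measurableC.
  by exact: bigcup_countType_measurable.
apply/seteqP; split=> w /=.
  case: xgetP => [b -> Lb <-|noL <-]; first by left.
  by right; rewrite eqxx => -[b _]; exact: noL.
case=> [La|]; first by case: xgetP => [b _ Lb|/(_ a)//]; exact: uL Lb La.
case: eqP => [->|//] noL; case: xgetP => // b _ Lb.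
by exfalso; apply: noL; exists b.
Qed.

End discrete_measurability.

Lemma dmeas_measurable_fun d d' (T : measurableType d) (V : measurableType d')
  (f : T -> V) : dmeas f -> measurable_fun [set: T] f.
Proof. by move=> mf _ B _; rewrite setTI. Qed.

Lemma dmeas_comp d d' (T : measurableType d) (V : measurableType d') (A : Type)
  (h : A -> V) (f : T -> A) : dmeas f -> measurable_fun [set: T] (fun w => h (f w)).
Proof. by move=> /(dmeas_map h); exact: dmeas_measurable_fun. Qed.

(** * Independence and laws of families of discrete variables *)

Section cylinders.
Variables (T : Type) (I : choiceType) (Z : I -> T -> nat).

(** These sets generate the sigma-algebra of the variables with index in [D]; when [Z] consists of
    the evaluations on a space of paths and [D] is [setT], this is the product sigma-algebra. *)
Definition coord_sets (D : set I) : set_system T :=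
  [set C | exists2 i, D i & exists B, C = Z i @^-1` B].

Definition cylinder (J : {fset I}) (B : I -> set nat) : set T :=
  \bigcap_(i in [set` J]) Z i @^-1` B i.

Definition cylinders (D : set I) : set_system T :=
  [set C | exists J B, [set` J] `<=` D /\ C = cylinder J B].

Lemma cylinders_setI D : setI_closed (cylinders D).
Proof.
move=> _ _ [J [B [JD ->]]] [J' [B' [JD' ->]]].
exists (J `|` J')%fset, (fun i => (if i \in J then B i else setT) `&`
                         (if i \in J' then B' i else setT)); split.
  by move=> i; rewrite /= in_fsetU => /orP[/JD|/JD'].
apply/seteqP; split=> w /=.
  move=> [HJ HJ'] i _ /=; split; case: ifP => // iJ; [exact: HJ|exact: HJ'].
move=> H; split=> i /= iJ.
  by have := H i; rewrite /= in_fsetU iJ => /(_ isT)[].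
by have := H i; rewrite /= in_fsetU iJ orbT => /(_ isT)[].
Qed.

Lemma coord_sets_cylinders D : coord_sets D `<=` cylinders D.
Proof.
move=> _ [i Di [B ->]]; exists [fset i]%fset, (fun=> B); split.
  by move=> j /=; rewrite inE => /eqP ->.
apply/seteqP; split=> w /=; first by move=> Bw j /=; rewrite inE => /eqP ->.
by apply; rewrite /= inE.
Qed.

End cylinders.

Lemma cylinder_measurable d (T : measurableType d) (I : choiceType)
    (Z : I -> T -> nat) J B : (forall i, dmeas (Z i)) -> measurable (cylinder Z J B).
Proof.
move=> mZ; apply: fin_bigcap_measurable => [|i _]; last exact: mZ.
exact: finite_fset.
Qed.

(** The pi-lambda theorem: cylinders are stable under intersection and generate the sigma-algebra.
    The empty index set gives the cylinder [setT], hence equality of the total masses. *)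
Lemma measure_unique_cylinders d (T : measurableType d) (R : realType)
    (I : choiceType) (Z : I -> T -> nat) (D : set I)
    (m1 m2 : {measure set T -> \bar R}) :
  (forall i, dmeas (Z i)) -> (m1 setT < +oo)%E ->
  (forall J B, [set` J] `<=` D -> m1 (cylinder Z J B) = m2 (cylinder Z J B)) ->
  forall C, <<s coord_sets Z D >> C -> m1 C = m2 C.
Proof.
move=> mZ m1oo m12 C HC.
have TE : cylinder Z fset0 (fun=> setT) = setT by apply/seteqP; split.
apply: (g_sigma_algebra_measure_unique_trace (cylinders Z D) setT) => //.
- by move=> _ [[J [B [_ ->]]] _]; exact: cylinder_measurable.
- by move=> A B [HA _] [HB _]; split => //; exact: cylinders_setI.
- by rewrite -TE m12// => i; rewrite /= in_fset0.
- by move=> _ [[J [B [JD ->]]] _]; exact: m12.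
- apply: sub_sigma_algebra2 HC => X HX; split => //.
  exact: coord_sets_cylinders.
Qed.

Section discrete_integral.
Local Open Scope ereal_scope.
Context d (T : measurableType d) (R : realType) (P : probability T R).

Lemma integral_over_values (N : T -> nat) (f : T -> R) : dmeas N ->
    measurable_fun setT f -> (forall w, (0 <= f w)%R) ->
  \int[P]_w (f w)%:E = \sum_(n <oo) \int[P]_(w in N @^-1` [set n]) (f w)%:E.
Proof.
move=> mN mf f0; rewrite -ge0_integral_bigcup//=.
- congr integral; apply/seteqP; split=> // w _; by exists (N w).
- exact/measurable_EFinP/measurable_funTS.
- by move=> w _; rewrite lee_fin.
- by apply/trivIsetP => i j _ _ /eqP ij; apply/seteqP; split=> // w [/= -> ].
Qed.

Lemma integral_discrete (E : set T) (N : T -> nat) (h : nat -> R) :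
    measurable E -> dmeas N -> (forall n, (0 <= h n)%R) ->
  \int[P]_(w in E) (h (N w))%:E =
  \sum_(n <oo) (h n)%:E * P (E `&` N @^-1` [set n]).
Proof.
move=> mE mN h0.
have EE : E = \bigcup_n (E `&` N @^-1` [set n]).
  by apply/seteqP; split=> [w Ew|w [n _ []]//]; exists (N w).
rewrite {1}EE ge0_integral_bigcup//=.
- apply: eq_eseriesr => n _.
  have mEn : measurable (E `&` N @^-1` [set n]) by apply: measurableI => //; exact: mN.
  rewrite -integral_cst//; apply: eq_integral => w; rewrite inE => -[_ /= ->] //.
- by move=> n; apply: measurableI => //; exact: mN.
- by apply/measurable_EFinP/measurable_funTS; exact: dmeas_comp.
- by move=> w _; rewrite lee_fin.
- by apply/trivIsetP => i j _ _ /eqP ij; apply/seteqP; split=> // w [[_ /= ->] [_ /= ]].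
Qed.

Lemma expectation_eq_law (N N' : T -> nat) (h : nat -> R) : dmeas N -> dmeas N' ->
    (forall n, P (N @^-1` [set n]) = P (N' @^-1` [set n])) -> (forall n, (0 <= h n)%R) ->
  \int[P]_w (h (N w))%:E = \int[P]_w (h (N' w))%:E.
Proof.
move=> mN mN' NN' h0; rewrite !integral_discrete//; apply: eq_eseriesr => n _.
by rewrite !setTI NN'.
Qed.

End discrete_integral.

Section independence.
Local Open Scope ereal_scope.
Context d (T : measurableType d) (R : realType) (P : probability T R).
Variables (I : choiceType) (Z : I -> T -> nat).
Hypothesis mZ : forall i, dmeas (Z i).
Hypothesis indepZ : forall (J : {fset I}) (B : I -> set nat),
  P (cylinder Z J B) = (\prod_(i <- J) P (Z i @^-1` B i))%E.

Lemma coord_sets_measurable D : <<s coord_sets Z D >> `<=` measurable.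
Proof.
apply: smallest_sub; first exact: sigma_algebra_measurable.
by move=> _ [i _ [B ->]]; exact: mZ.
Qed.

(** For fixed [B], both sides are finite measures in [C]. They are compared on the cylinders over
    [D]: intersecting one with an event on [Z k], where [k] is outside [D], gives a cylinder with
    one more index. *)
Lemma independent_coord D k C B : ~ D k -> <<s coord_sets Z D >> C ->
  P (C `&` Z k @^-1` B) = P (Z k @^-1` B) * P C.
Proof.
move=> Dk HC.
have mB : measurable (Z k @^-1` B) by exact: mZ.
have B0 : (0 <= fine (P (Z k @^-1` B)))%R by exact: fine_ge0.
have -> : P (Z k @^-1` B) * P C = mscale (NngNum B0) P C.
  by rewrite /mscale/= fineK// fin_num_measure.
apply: (measure_unique_cylinders (m1 := mrestr P mB) mZ _ _ HC).
  by rewrite /= /mrestr setTI ltey_eq fin_num_measure.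
move=> J E JD; rewrite /= /mrestr /mscale/= fineK ?fin_num_measure//.
have kJ : k \notin J by apply/negP => /JD.
have -> : cylinder Z J E `&` Z k @^-1` B =
    cylinder Z (k |` J)%fset (fun i => if i == k then B else E i).
  apply/seteqP; split=> w /=.
    move=> [HJ HB] i /=; rewrite in_fset1U; case: eqP => [-> //|_ /= iJ]; exact: HJ.
  move=> H; split; last by have /= := H k (fset1U1 _ _); rewrite eqxx.
  move=> i /= iJ; have /= := H i (fset1Ur _ iJ); case: eqP => // ik.
  by move: kJ; rewrite -ik iJ.
rewrite !indepZ big_fsetU1//= eqxx; congr (_ * _).
apply: eq_big_seq => i iJ; case: eqP => // ik.
by move: kJ; rewrite -ik iJ.
Qed.

(** Splitting along the values of [Z k] and of [N] reduces the product formula to events. [N] is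
    pickled to take values in [nat]; as the mean of [h (N w)] is finite, it can be pulled out of the
    series as a real factor. *)
Lemma expectation_indep D k (A : countType)
    (N : T -> A) (h : A -> R) (g : nat -> R) :
  ~ D k -> @dmeas _ (g_sigma_algebraType (coord_sets Z D)) A N ->
  (forall a, (0 <= h a)%R) -> (forall n, (0 <= g n)%R) ->
  \int[P]_w (h (N w))%:E < +oo ->
  \int[P]_w (h (N w) * g (Z k w))%:E =
  \int[P]_w (h (N w))%:E * \int[P]_w (g (Z k w))%:E.
Proof.
move=> Dk mN h0 g0 hoo.
have mN' : dmeas N by move=> B; apply: coord_sets_measurable; exact: mN.
pose M w := choice.pickle (N w).
pose f n := if choice.unpickle n is Some a then h a else 0%R.
have hf w : h (N w) = f (M w) by rewrite /f choice.pickleK.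
have f0 n : (0 <= f n)%R by rewrite /f; case: choice.unpickle.
have mM : dmeas M by exact: dmeas_map.
have mZk n : measurable (Z k @^-1` [set n]) by exact: mZ.
rewrite [LHS](integral_over_values _ (mZ k))//; last 2 first.
- exact: (dmeas_comp (fun x => h x.1 * g x.2)%R (dmeas_pair mN' (mZ k))).
- by move=> w; apply: mulr_ge0.
transitivity (\sum_(n <oo) \int[P]_w (h (N w))%:E * ((g n)%:E * P (Z k @^-1` [set n]))).
  apply: eq_eseriesr => n _.
  transitivity (\int[P]_(w in Z k @^-1` [set n]) ((g n)%:E * (h (N w))%:E)).
    by apply: eq_integral => w; rewrite inE /= => ->; rewrite -EFinM mulrC.
  rewrite ge0_integralZl//; last 3 first.
  - by apply/measurable_EFinP/measurable_funTS; exact: dmeas_comp.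
  - by move=> w _; rewrite lee_fin.
  - by rewrite lee_fin.
  rewrite [RHS]muleCA; congr (_ * _).
  under eq_integral do rewrite hf.
  under [in RHS]eq_integral do rewrite hf.
  rewrite !integral_discrete// muleC -(fineK (fin_num_measure P _ (mZk n))).
  rewrite -nneseriesZl//; last by move=> i _; rewrite mule_ge0// lee_fin.
  apply: eq_eseriesr => i _; rewrite setTI setIC (independent_coord (D := D))//; last first.
    exact: (mN (choice.pickle @^-1` [set i])).
  by rewrite muleCA fineK// fin_num_measure.
rewrite -(@fineK _ (\int[P]_w (h (N w))%:E)); last first.
  by rewrite ge0_fin_numE// integral_ge0// => w _; rewrite lee_fin.
rewrite nneseriesZl; last by move=> i _; rewrite mule_ge0// lee_fin.
congr (_ * _); rewrite integral_discrete//; apply: eq_eseriesr => n _.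
by rewrite setTI.
Qed.

End independence.

Section laws.
Context d (T : measurableType d) (R : realType) (P : probability T R).
Variables (I : choiceType) (Z Z' : I -> T -> nat).
Hypotheses (mZ : forall i, dmeas (Z i)) (mZ' : forall i, dmeas (Z' i)).

Let S := g_sigma_algebraType (coord_sets (fun i (e : I -> nat) => e i) setT).

Let measurable_path (V : I -> T -> nat) : (forall i, dmeas (V i)) ->
  @measurable_fun _ _ T S setT (fun w => V ^~ w).
Proof.
move=> mV; apply: (@measurability _ _ T S _ _ (coord_sets (fun i e => e i) setT)) => //.
by move=> _ [_ [i _ [B ->]] <-]; rewrite setTI; exact: mV.
Qed.

(** The two laws are image measures on the space of paths [I -> nat], whose product sigma-algebra is
    generated by the cylinders. *)
Lemma law_unique :
  (forall J B, P (cylinder Z J B) = P (cylinder Z' J B)) ->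
  forall C, <<s coord_sets (fun i (e : I -> nat) => e i) setT >> C ->
    P [set w | C (Z ^~ w)] = P [set w | C (Z' ^~ w)].
Proof.
move=> PZ C HC.
pose F V (mV : forall i, dmeas (V i)) : {mfun T >-> S} :=
  HB.pack (fun w => V ^~ w : S) (isMeasurableFun.Build _ _ _ _ _ (measurable_path mV)).
pose m1 : {measure set S -> \bar R} := distribution P (F Z mZ).
pose m2 : {measure set S -> \bar R} := distribution P (F Z' mZ').
suff : m1 C = m2 C by [].
apply: (@measure_unique_cylinders _ S R I (fun i e => e i) setT m1 m2) => //.
- move=> i B; apply: sub_sigma_algebra; exists i => //; by exists B.
- by rewrite /m1/= /distribution /pushforward preimage_setT probability_setT ltry.
- by move=> J B _; exact: PZ.
Qed.

End laws.

(** A finite index set splits into its left and its right indices. Each of the two partial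
    intersections lies in one of the two generated sigma-algebras, whose independence factors the
    probability. *)
Lemma mutually_independent_sum d (T : measurableType d) (R : realType)
    (P : probability T R) (I1 I2 : choiceType)
    (F1 : I1 -> set_system T) (F2 : I2 -> set_system T) :
  mutually_independent P F1 -> mutually_independent P F2 ->
  independent2 P <<s \bigcup_(i in [set: I1]) F1 i >>
                 <<s \bigcup_(i in [set: I2]) F2 i >> ->
  mutually_independent P
    (fun k : (I1 + I2)%type => match k with inl i => F1 i | inr i => F2 i end).
Proof.
move=> indep1 indep2 indep12 J E HE.
pose J1 := seq_fset tt (pmap (fun k => if k is inl i then Some i else None) J)
  : {fset I1}.
pose J2 := seq_fset tt (pmap (fun k => if k is inr i then Some i else None) J)
  : {fset I2}.
have inJ1 i : (i \in J1) = (inl i \in J).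
  rewrite seq_fsetE mem_pmap; apply/mapP/idP => [[[j|j]//= jJ [->//]]|iJ].
  by exists (inl i).
have inJ2 i : (i \in J2) = (inr i \in J).
  rewrite seq_fsetE mem_pmap; apply/mapP/idP => [[[j|j]//= jJ [->//]]|iJ].
  by exists (inr i).
have JE : perm_eq J (map inl J1 ++ map inr J2).
  apply: uniq_perm.
  - exact: fset_uniq.
  - rewrite cat_uniq !map_inj_uniq ?fset_uniq//=; try by move=> ? ? [].
    by rewrite andbT; apply/hasPn => _ /mapP[i _ ->]; apply/negP => /mapP[].
  move=> [i|i]; rewrite mem_cat.
    rewrite mem_map ?inJ1; last by move=> ? ? [].
    by rewrite orbC; case: mapP => // -[].
  rewrite orbC mem_map ?inJ2; last by move=> ? ? [].
  by rewrite orbC; case: mapP => // -[].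
rewrite (perm_big _ JE) big_cat !big_map/=.
rewrite -(indep1 J1 (E \o inl)); last by move=> i; rewrite inJ1 => /HE.
rewrite -(indep2 J2 (E \o inr)); last by move=> i; rewrite inJ2 => /HE.
have capE : \bigcap_(k in [set` J]) E k =
    \bigcap_(i in [set` J1]) E (inl i) `&` \bigcap_(i in [set` J2]) E (inr i).
  apply/seteqP; split=> w.
    by move=> H; split=> i /=; rewrite (inJ1, inJ2); exact: H.
  by move=> [H1 H2] [i|i] /= iJ; [apply: H1|apply: H2]; rewrite /= (inJ1, inJ2).
rewrite capE indep12//.
- apply: (@fin_bigcap_measurable _ (g_sigma_algebraType (\bigcup_i F1 i))) => [|i /=].
    exact: finite_fset.
  by rewrite inJ1 => /HE Ei; apply: sub_sigma_algebra; exists i.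
- apply: (@fin_bigcap_measurable _ (g_sigma_algebraType (\bigcup_i F2 i))) => [|i /=].
    exact: finite_fset.
  by rewrite inJ2 => /HE Ei; apply: sub_sigma_algebra; exists i.
Qed.

(** * Picard iterates *)

Section picard.
Variables (p q : nat).
Implicit Types (u : int -> 'cV[nat]_p) (y : int -> int -> 'I_q -> 'I_p -> 'I_p -> nat).

(** Deterministic: [u] and [y] are one path of the noise, so that monotonicity, limits and shifts
    are treated path by path. *)
Definition recursion u y (x : int -> 'cV[nat]_p) (t : int) : 'cV[nat]_p :=
  \sum_(j < q) thinning_mx (fun i l s => y s t j i l) (x (t - (j.+1)%:Z)) + u t.

Fixpoint picard u y (n : nat) : int -> 'cV[nat]_p :=
  if n is m.+1 then recursion u y (picard u y m) else fun=> 0.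

(* Equal to 0 where the iterates are not eventually constant. *)
Definition picard_lim u y (t : int) : 'cV[nat]_p :=
  xget 0 [set x | exists N, forall n, (N <= n)%N -> picard u y n t = x].

Lemma recursionE u y x t i : recursion u y x t i ord0 =
  (\sum_(j < q) \sum_(l < p) thinning (fun s => y s t j i l) (x (t - (j.+1)%:Z)%R l ord0)
   + u t i ord0)%N.
Proof.
rewrite /recursion mxE summxE; congr (_ + _)%N.
by apply: eq_bigr => j _; rewrite mxE.
Qed.

Lemma leq_thinning (y : int -> nat) m n : (m <= n)%N -> (thinning y m <= thinning y n)%N.
Proof.
by move=> mn; rewrite /thinning [leqRHS](big_cat_nat _ (n := m.+1))//= leq_addr.
Qed.

Lemma picard_mono u y n t i : (picard u y n t i ord0 <= picard u y n.+1 t i ord0)%N.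
Proof.
elim: n t i => [|n IH] t i; first by rewrite mxE.
rewrite [picard u y n.+2]/= [picard u y n.+1]/= !recursionE leq_add2r.
by apply: leq_sum => j _; apply: leq_sum => l _; apply: leq_thinning.
Qed.

Lemma picard_homo u y t i m n : (m <= n)%N ->
  (picard u y m t i ord0 <= picard u y n t i ord0)%N.
Proof. exact: (homo_leq (fun _ => leqnn _) leq_trans (fun n => picard_mono u y n t i)). Qed.

(** Only the upper time index of [y] moves; the lower one merely numbers the offspring. *)
Lemma picard_shift u y h n t :
  picard (fun t => u (t + h)) (fun s t => y s (t + h)) n t = picard u y n (t + h).
Proof.
elim: n t => [//|n IH] t; rewrite /= /recursion; congr (_ + _).
by apply: eq_bigr => j _; rewrite IH addrAC.
Qed.

Lemma picard_lim_shift u y h t :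
  picard_lim (fun t => u (t + h)) (fun s t => y s (t + h)) t = picard_lim u y (t + h).
Proof.
rewrite /picard_lim; congr xget; apply/seteqP.
by split=> x [N HN]; exists N => n Nn; rewrite -(HN n Nn) picard_shift.
Qed.

(** A nondecreasing bounded sequence of natural numbers is eventually constant; this is applied to
    each of the [p] coordinates. *)
Lemma picard_limP u y t : (exists M, forall n i, (picard u y n t i ord0 <= M)%N) ->
  exists N, forall n, (N <= n)%N -> picard u y n t = picard_lim u y t.
Proof.
move=> [M HM].
suff [x Hx] : exists x, exists N, forall n, (N <= n)%N -> picard u y n t = x.
  by rewrite /picard_lim; case: xgetP => [x' _ //|/(_ x)].
have Hi i : exists N, forall n, (N <= n)%N -> picard u y n t i ord0 = picard u y N t i ord0.
  pose Q m := `[< exists n, picard u y n t i ord0 = m >].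
  have exQ : exists m, Q m by exists (picard u y 0 t i ord0); apply/asboolP; exists 0%N.
  have bQ m : Q m -> (m <= M)%N by move=> /asboolP[n <-].
  case: (ex_maxnP exQ bQ) => m /asboolP[N Nm] Hm; exists N => n Nn.
  apply/eqP; rewrite eqn_leq (picard_homo _ _ _ _ Nn) andbT Nm; apply: Hm.
  by apply/asboolP; exists n.
have [N HN] := choice Hi.
exists (\col_i picard u y (N i) t i ord0), (\max_i N i)%N => n Nn.
by apply/colP => i; rewrite mxE; apply: HN; apply: leq_trans Nn; exact: leq_bigmax.
Qed.

(** Valid on every path: where the iterates do not stabilise, the default value 0 lies below them.
    Bounds on expectations thus pass to the limit without discarding a null set. *)
Lemma picard_lim_le u y t i : exists N, forall n, (N <= n)%N ->
  (picard_lim u y t i ord0 <= picard u y n t i ord0)%N.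
Proof.
rewrite /picard_lim; case: xgetP => [x _ [N HN]|_].
  by exists N => n Nn; rewrite HN.
by exists 0%N => n _; rewrite mxE.
Qed.

Lemma picard_lim_recursion u y t :
  (forall t, exists M, forall n i, (picard u y n t i ord0 <= M)%N) ->
  picard_lim u y t = recursion u y (picard_lim u y) t.
Proof.
move=> bnd; have [N HN] := choice (fun t => picard_limP (bnd t)).
(* At [n] the iterates have stabilised at the [q] earlier times read by the recursion, and at [n.+1]
   also at time [t]. *)
pose n := (maxn (N t) (\max_(j < q) N (t - (j.+1)%:Z)%R))%N.
rewrite -(HN t n.+1) /=; last exact: leq_trans (leq_maxl _ _) (leqnSn _).
rewrite /recursion; congr (_ + _).
apply: eq_bigr => j _; rewrite HN//; apply: leq_trans (leq_maxr _ _).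
exact: (leq_bigmax (F := fun j : 'I_q => N (t - (j.+1)%:Z))).
Qed.

End picard.

Section picard_measurable.
Context (p q : nat) d (T : measurableType d).
Variables (u : int -> T -> 'cV[nat]_p) (y : int -> int -> 'I_q -> 'I_p -> 'I_p -> T -> nat).
Variable t0 : int.
Hypothesis mu : forall t, t <= t0 -> dmeas (u t).
Hypothesis my : forall s t j i l, t <= t0 -> dmeas (y s t j i l).

(** [T] is any measurable space on which the noise up to [t0] is measurable. With the sigma-algebra
    of a past in its place, measurability expresses that the construction does not look ahead. *)
Lemma dmeas_recursion (x : int -> T -> 'cV[nat]_p) t : t <= t0 ->
  (forall j : 'I_q, dmeas (x (t - (j.+1)%:Z))) ->
  dmeas (fun w => recursion (u ^~ w) (fun s t j i l => y s t j i l w) (x ^~ w) t).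
Proof.
move=> tt0 mx.
rewrite (_ : (fun _ => _) = fun w => (\col_i (\sum_(j < q) \sum_(l < p)
    thinning (fun s => y s t j i l w) (x (t - (j.+1)%:Z)%R w l ord0) +
   u t w i ord0)%N : 'cV[nat]_p)); last first.
  by apply/funext => w; apply/colP => i; rewrite recursionE mxE.
apply: dmeas_col => i.
apply: (dmeas_bind (A' := nat) (f := u t)
  (g := fun a w => (\sum_(j < q) \sum_(l < p)
    thinning (fun s => y s t j i l w) (x (t - (j.+1)%:Z)%R w l ord0) + a i ord0)%N)).
  exact: mu.
move=> a; apply: (dmeas_map (fun m => m + a i ord0)%N).
apply: dmeas_big => j; apply: dmeas_big => l; apply: dmeas_thinning.
  by move=> s; exact: my.
exact: (dmeas_map (fun v : 'cV[nat]_p => v l ord0)).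
Qed.

Lemma dmeas_picard n t : t <= t0 ->
  dmeas (fun w => picard (u ^~ w) (fun s t j i l => y s t j i l w) n t).
Proof.
elim: n t => [|n IH] t tt0; first exact: dmeas_cst.
apply: (dmeas_recursion (x := fun t w => picard (u ^~ w) (fun s t j i l => y s t j i l w) n t)) => // j.
by apply: IH; rewrite (le_trans _ tt0)// lerBlDr lerDl.
Qed.

Lemma dmeas_picard_lim t : t <= t0 ->
  dmeas (fun w => picard_lim (u ^~ w) (fun s t j i l => y s t j i l w) t).
Proof. by move=> tt0; apply: dmeas_eventually => n; exact: dmeas_picard. Qed.

End picard_measurable.

(** * Expectations and real inequalities *)

Section expectation_lemmas.
Local Open Scope ereal_scope.
Context d (T : measurableType d) (R : realType) (P : probability T R).

Lemma expectation_sum (I : Type) (r : seq I) (F : I -> T -> nat) :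
  (forall i, dmeas (F i)) ->
  \int[P]_w ((\sum_(i <- r) F i w)%N%:R : R)%:E = \sum_(i <- r) \int[P]_w ((F i w)%:R)%:E.
Proof.
move=> mF; rewrite -ge0_integral_sum//.
- by apply: eq_integral => w _; rewrite natr_sum sumEFin.
- by move=> i; apply/measurable_EFinP; exact: dmeas_comp.
Qed.

Lemma expectationD (f g : T -> nat) : dmeas f -> dmeas g ->
  \int[P]_w ((f w + g w)%N%:R : R)%:E = \int[P]_w ((f w)%:R)%:E + \int[P]_w ((g w)%:R)%:E.
Proof.
move=> mf mg; rewrite -ge0_integralD//; try by apply/measurable_EFinP; exact: dmeas_comp.
by apply: eq_integral => w _; rewrite natrD EFinD.
Qed.

Lemma expectation_lin_le (f g : T -> R) (a b c e : R) :
  measurable_fun setT f -> measurable_fun setT g ->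
  (forall w, (0 <= f w)%R) -> (forall w, (0 <= g w)%R) -> (0 <= a)%R -> (0 <= b)%R ->
  \int[P]_w (f w)%:E <= c%:E -> \int[P]_w (g w)%:E <= e%:E ->
  \int[P]_w (a * f w + b * g w)%:E <= (a * c + b * e)%:E.
Proof.
move=> mf mg f0 g0 a0 b0 fc ge.
have mfE : measurable_fun setT (fun w => (f w)%:E) by exact/measurable_EFinP.
have mgE : measurable_fun setT (fun w => (g w)%:E) by exact/measurable_EFinP.
under eq_integral do rewrite EFinD !EFinM.
rewrite ge0_integralD//; last 4 first.
- by move=> w _; rewrite mule_ge0// lee_fin.
- by apply: measurable_funeM.
- by move=> w _; rewrite mule_ge0// lee_fin.
- by apply: measurable_funeM.
rewrite !ge0_integralZl_EFin//; try by move=> w _; rewrite lee_fin.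
by rewrite EFinD !EFinM; apply: leeD; rewrite lee_wpmul2l// lee_fin.
Qed.

Lemma expectation_le (f g : T -> R) :
  measurable_fun setT f -> measurable_fun setT g ->
  (forall w, (0 <= f w)%R) -> (forall w, (f w <= g w)%R) ->
  \int[P]_w (f w)%:E <= \int[P]_w (g w)%:E.
Proof.
move=> mf mg f0 fg; apply: ge0_le_integral => //.
- by move=> w _; rewrite lee_fin.
- exact/measurable_EFinP.
- exact/measurable_EFinP.
- by move=> w _; rewrite lee_fin.
Qed.

Variables (f : nat -> T -> R) (c : R).
Hypothesis mf : forall n, measurable_fun setT (f n).
Hypothesis f0 : forall n w, (0 <= f n w)%R.
Hypothesis f_homo : forall w m n, (m <= n)%N -> (f m w <= f n w)%R.
Hypothesis fc : forall n, \int[P]_w (f n w)%:E <= c%:E.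

Let homo w : {homo (fun n => (f n w)%:E) : m n / (m <= n)%N >-> m <= n}.
Proof. by move=> m n mn; rewrite lee_fin; exact: f_homo. Qed.

Let cvgf w : cvgn (fun n => (f n w)%:E).
Proof. exact: ereal_nondecreasing_is_cvgn. Qed.

Let le_limf w n : (f n w)%:E <= limn (fun n => (f n w)%:E).
Proof.
apply: lime_ge; first exact: cvgf.
by exists n => // m /= nm; exact: homo.
Qed.

Let limf_le : \int[P]_w limn (fun n => (f n w)%:E) <= c%:E.
Proof.
rewrite monotone_convergence//.
- apply: lime_le; last by apply: nearW => n; exact: fc.
  apply: ereal_nondecreasing_is_cvgn => m n mn.
  by apply: ge0_le_integral => //; try exact/measurable_EFinP; move=> w _;
    rewrite ?lee_fin//; exact: f_homo.
- by move=> n; exact/measurable_EFinP.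
- by move=> n w _; rewrite lee_fin.
Qed.

Let mlim : measurable_fun setT (fun w => limn (fun n => (f n w)%:E)).
Proof.
apply: (emeasurable_fun_cvg (fun n w => (f n w)%:E)).
  by move=> n; exact/measurable_EFinP.
by move=> w _; exact: cvgf.
Qed.

(** By monotone convergence the limit of the [f n] has mean at most [c], and it dominates [g] at
    every point. *)
Lemma monotone_expectation_le (g : T -> R) :
  measurable_fun setT g -> (forall w, (0 <= g w)%R) ->
  (forall w, exists n, (g w <= f n w)%R) -> \int[P]_w (g w)%:E <= c%:E.
Proof.
move=> mg g0 gf; apply: le_trans limf_le; apply: ge0_le_integral => //.
- by move=> w _; rewrite lee_fin.
- exact/measurable_EFinP.
- by move=> w _; have [n gn] := gf w; apply: le_trans (le_limf w n); rewrite lee_fin.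
Qed.

(** The limit has finite mean, hence is finite almost everywhere. *)
Lemma monotone_bounded_ae : {ae P, forall w, exists M : R, forall n, (f n w <= M)%R}.
Proof.
have int : P.-integrable setT (fun w => limn (fun n => (f n w)%:E)).
  apply/integrableP; split => //; apply: le_lt_trans (ltry c).
  apply: le_trans limf_le; rewrite le_eqVlt; apply/orP; left; apply/eqP.
  apply: eq_integral => w _; rewrite gee0_abs//.
  by apply: le_trans (le_limf w 0); rewrite lee_fin.
apply: filterS (integrable_ae measurableT int) => w /(_ I) fin.
exists (fine (limn (fun n => (f n w)%:E))) => n.
by rewrite -lee_fin fineK.
Qed.

End expectation_lemmas.

(** Choose h > 0 with (1 + h)^b = 1 + e. If y <= h x, the sum is at most (1 + h) x; otherwise it is
    at most (1 + 1/h) y, and [C] is (1 + 1/h)^b. *)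
Lemma powR_add_le (R : realType) (b e : R) : 0 < b -> 0 < e ->
  exists2 C : R, 0 <= C & forall x y : R, 0 <= x -> 0 <= y ->
    (x + y) `^ b <= (1 + e) * x `^ b + C * y `^ b.
Proof.
move=> b0 e0; have b0' : b != 0 by rewrite gt_eqF.
pose h := (1 + e) `^ b^-1 - 1.
have h0 : 0 < h.
  have E1 : (1 : R) `^ b^-1 = 1 by rewrite powR1.
  by rewrite subr_gt0 -{1}E1 gt0_ltr_powR ?invr_gt0// ?nnegrE; lra.
have hb : (1 + h) `^ b = 1 + e.
  by rewrite /h addrC subrK -powRrM mulVf// powRr1//; lra.
clearbody h; exists ((1 + h^-1) `^ b); first exact: powR_ge0.
move=> x y x0 y0; have [yx|xy] := lerP y (h * x).
  apply: (@le_trans _ _ (((1 + h) * x) `^ b)).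
    have hx : 0 <= h * x := mulr_ge0 (ltW h0) x0.
    by apply: ge0_ler_powR; rewrite ?nnegrE ?mulrDl ?mul1r; lra.
  rewrite powRM//; last lra.
  by rewrite hb lerDl mulr_ge0// powR_ge0.
have hy : x <= h^-1 * y by rewrite ler_pdivlMl// ltW.
apply: (@le_trans _ _ (((1 + h^-1) * y) `^ b)).
  have hy0 : 0 <= h^-1 * y by rewrite mulr_ge0// invr_ge0 ltW.
  by apply: ge0_ler_powR; rewrite ?nnegrE ?mulrDl ?mul1r; lra.
have h1 : 0 < h^-1 by rewrite invr_gt0.
rewrite powRM//; last lra.
by rewrite lerDr mulr_ge0 ?powR_ge0//; lra.
Qed.

(** Young's inequality with exponents r and r/b, where b = r - 1, applied to the factors a^(-b/r) x
    and a^(b/r) w^b. *)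
Lemma young_powR (R : realType) (r a x w : R) : 1 < r -> 0 < a -> 0 <= x -> 0 <= w ->
  x * w `^ (r - 1) <= a `^ (- (r - 1)) * x `^ r / r + a * (1 - r^-1) * w `^ r.
Proof.
move=> r1 a0 x0 w0; set b := r - 1.
have b0 : 0 < b by rewrite /b; lra.
have r0 : 0 < r by lra.
have := @conjugate_powR R (a `^ (- b / r) * x) (a `^ (b / r) * w `^ b) r (r / b).
rewrite !mulr_ge0 ?powR_ge0// => /(_ isT isT r0 (divr_gt0 r0 b0)).
have -> : r^-1 + (r / b)^-1 = 1 by rewrite /b; field; rewrite -/b; apply/andP; split; lra.
move=> /(_ erefl).
have -> : a `^ (- b / r) * x * (a `^ (b / r) * w `^ b) = x * w `^ b.
  rewrite mulrACA -powRD; last by rewrite implybE orbC gt_eqF.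
  by rewrite mulNr addNr powRr0 mul1r mulrC.
rewrite !powRM ?powR_ge0// -!powRrM.
have -> : - b / r * r = - b by field; lra.
have -> : b / r * (r / b) = 1 by field; apply/andP; split; lra.
have -> : b * (r / b) = r by field; lra.
rewrite (powRr1 (ltW a0)).
have -> : a * w `^ r / (r / b) = a * (1 - r^-1) * w `^ r.
  by rewrite /b; field; rewrite -/b; apply/andP; split; lra.
by [].
Qed.

(** * The autoregression *)

(** The distance |m - n|: at least one of the two truncated differences is 0. *)
Definition ndist (m n : nat) : nat := (m - n + (n - m))%N.

Lemma ndist0 n : ndist n 0 = n. Proof. by rewrite /ndist subn0 sub0n addn0. Qed.

Lemma ndist_sum (I : Type) (r : seq I) (F G : I -> nat) :
  (ndist (\sum_(i <- r) F i) (\sum_(i <- r) G i) <= \sum_(i <- r) ndist (F i) (G i))%N.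
Proof.
elim: r => [|i r IH]; first by rewrite !big_nil.
rewrite !big_cons; move: IH; rewrite /ndist; lia.
Qed.

(** The range no longer depends on [m], which enters through indicators only. The terms are
    renumbered from 0, hence [y s.+1]. *)
Lemma thinning_sum (y : int -> nat) (m M : nat) : (m <= M)%N ->
  thinning y m = (\sum_(0 <= s < M) (s < m) * y s.+1)%N.
Proof.
move=> mM; rewrite /thinning big_add1 /= (big_cat_nat _ (n := m) (p := M))//=.
rewrite [X in (_ + X)%N]big_nat_cond [X in (_ + X)%N]big1 ?addn0; last first.
  by move=> s /andP[/andP[ms _] _]; rewrite ltnNge ms.
by apply: eq_big_nat => s /andP[_ sm]; rewrite sm mul1n.
Qed.

(** Both thinnings use the same [y], so that only the [s] between [m] and [n], marked by the
    exclusive or, contribute. *)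
Lemma ndist_thinning (y : int -> nat) (m n M : nat) : (m <= M)%N -> (n <= M)%N ->
  ndist (thinning y m) (thinning y n) =
  (\sum_(0 <= s < M) ((s < m) (+) (s < n)) * y s.+1)%N.
Proof.
move=> mM nM; rewrite !(@thinning_sum y _ M)//.
wlog mn : m n mM nM / (m <= n)%N.
  move=> H; have [mn|/ltnW mn] := leqP m n; first exact: H.
  rewrite /ndist addnC [LHS]H//; apply: eq_bigr => s _; by rewrite addbC.
rewrite /ndist; set a := (\sum_(0 <= s < M) (s < m) * _)%N.
set b := (\sum_(0 <= s < M) (s < n) * _)%N.
set c := (X in _ = X).
suff : b = (a + c)%N by lia.
rewrite /a /b /c -big_split /=; apply: eq_bigr => s _.
by have [sm|ms] := ltnP s m; [rewrite (leq_trans sm mn) addn0|rewrite add0n].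
Qed.

Lemma ndist_count (m n M : nat) : (m <= M)%N -> (n <= M)%N ->
  ndist m n = (\sum_(0 <= s < M) ((s < m) (+) (s < n)))%N.
Proof.
have thin1 k : thinning (fun=> 1%N) k = k.
  by rewrite /thinning sum_nat_const_nat subSS subn0 muln1.
move=> mM nM; have := ndist_thinning (fun=> 1%N) mM nM; rewrite !thin1 => ->.
by apply: eq_bigr => s _; rewrite muln1.
Qed.

Lemma eseries_finite (R : realType) (f : nat -> \bar R) (M : nat) :
  (forall n, (M <= n)%N -> f n = 0%E) ->
  (\sum_(n <oo) f n = \sum_(0 <= n < M) f n)%E.
Proof.
move=> f0; apply: lim_near_cst => //; exists M => // n /= Mn.
rewrite (big_cat_nat _ (n := M))//= [X in (_ + X)%E]big_nat_cond.
by rewrite [X in (_ + X)%E]big1 ?adde0// => i /andP[/andP[/f0]].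
Qed.

Section model.
Local Open Scope ereal_scope.
Context d (T : measurableType d) (R : realType) (P : probability T R) (p q : nat).
Variables (U : int -> T -> 'cV[nat]_p)
          (Y : int -> int -> 'I_q -> 'I_p -> 'I_p -> T -> nat)
          (A : 'I_q -> 'M[R]_p).

Definition noise_index := (int + int * int * 'I_q * 'I_p * 'I_p)%type.

(* The vectors [U t] are pickled so that the whole noise is one family of
   nat-valued variables. *)
Definition noise (k : noise_index) : T -> nat :=
  match k with
  | inl t => fun w => choice.pickle (U t w)
  | inr (s, t, j, i, l) => Y s t j i l
  end.

Definition noise_time (k : noise_index) : int :=
  match k with inl t => t | inr (s, t, j, i, l) => t end.

Definition before (t : int) : set noise_index := [set k | (noise_time k < t)%R].

Hypothesis mU : forall t, dmeas (U t).
Hypothesis mY : forall s t j i l, dmeas (Y s t j i l).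
Hypothesis noise_indep : forall (J : {fset noise_index}) (B : noise_index -> set nat),
  P (cylinder noise J B) = (\prod_(i <- J) P (noise i @^-1` B i))%E.
Hypothesis Y_mean : forall s t j i l, \int[P]_w ((Y s t j i l w)%:R)%:E = (A j i l)%:E.

Let G (D : set noise_index) := g_sigma_algebraType (coord_sets noise D).

Lemma dmeas_noise k : dmeas (noise k).
Proof.
by case: k => [t|[[[[s t] j] i] l]] /=; [apply: dmeas_map|exact: mY].
Qed.

Lemma dmeas_U D t : D (inl t) -> @dmeas _ (G D) _ (U t).
Proof.
move=> Dt B; apply: sub_sigma_algebra; exists (inl t) => //.
(* Pickling is injective, so events on [U t] are events on its code. *)
exists [set n | exists2 v, B v & n = choice.pickle v]; apply/seteqP; split=> w /=.
  by move=> Bw; exists (U t w).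
by move=> [v Bv /(pcan_inj choice.pickleK) ->].
Qed.

Lemma dmeas_Y D s t j i l : D (inr (s, t, j, i, l)) -> @dmeas _ (G D) _ (Y s t j i l).
Proof.
by move=> Dt B; apply: sub_sigma_algebra; exists (inr (s, t, j, i, l)) => //; exists B.
Qed.

Lemma dmeas_coarse D (V : Type) (f : T -> V) : @dmeas _ (G D) _ f -> dmeas f.
Proof. by move=> mf B; apply: (coord_sets_measurable dmeas_noise); exact: mf. Qed.

Lemma A_ge0 j i l : (0 <= A j i l)%R.
Proof.
by rewrite -lee_fin -(Y_mean 0 0); apply: integral_ge0 => w _; rewrite lee_fin.
Qed.

(** Wald's identity for a difference. Whether exactly one of [N] and [N'] exceeds [s] is decided
    before time [t], hence is independent of the offspring variable of index [s.+1] at time [t]. *)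
Lemma expectation_ndist_thinning t j i l (N N' : T -> nat) :
    @dmeas _ (G (before t)) _ N -> @dmeas _ (G (before t)) _ N' ->
  \int[P]_w ((ndist (thinning (fun s => Y s t j i l w) (N w))
                    (thinning (fun s => Y s t j i l w) (N' w)))%:R)%:E =
  (A j i l)%:E * \int[P]_w ((ndist (N w) (N' w))%:R)%:E.
Proof.
move=> mN mN'.
pose b (s : nat) w : R := ((s < N w) (+) (s < N' w))%N%:R.
have mNN : @dmeas _ (G (before t)) _ (fun w => (N w, N' w)) by exact: dmeas_pair.
have mNN' := dmeas_coarse mNN.
have b0 s w : (0 <= b s w)%R by [].
have mb s : measurable_fun setT (EFin \o b s).
  by apply/measurable_EFinP; exact: (dmeas_comp (fun x => ((s < x.1) (+) (s < x.2))%N%:R : R) mNN').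
have -> : \int[P]_w ((ndist (N w) (N' w))%:R)%:E = \sum_(s <oo) \int[P]_w (b s w)%:E.
  rewrite -integral_nneseries//; last by move=> s w _; rewrite lee_fin.
  apply: eq_integral => w _.
  rewrite (@eseries_finite _ _ (maxn (N w) (N' w))); last first.
    by move=> n; rewrite /b geq_max => /andP[Nn N'n]; rewrite !ltnNge Nn N'n.
  by rewrite (ndist_count (leq_maxl (N w) (N' w)) (leq_maxr _ _)) natr_sum sumEFin.
rewrite -nneseriesZl; last first.
  by move=> s _; apply: integral_ge0 => w _; rewrite lee_fin.
transitivity (\sum_(s <oo) \int[P]_w (b s w * (Y s.+1 t j i l w)%:R)%:E).
  rewrite -integral_nneseries//.
  - apply: eq_integral => w _.
    rewrite (@eseries_finite _ _ (maxn (N w) (N' w))); last first.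
      move=> n; rewrite /b geq_max => /andP[Nn N'n]; rewrite !ltnNge Nn N'n.
      by rewrite mul0r.
    rewrite (ndist_thinning _ (leq_maxl (N w) (N' w)) (leq_maxr _ _)) natr_sum sumEFin.
    by congr EFin; apply: eq_bigr => s _; rewrite natrM.
  - move=> s; apply/measurable_EFinP.
    exact: (dmeas_comp (fun x => ((s < x.1.1) (+) (s < x.1.2))%N%:R * x.2%:R : R)%R
             (dmeas_pair mNN' (mY s.+1 t j i l))).
  - by move=> s w _; rewrite lee_fin mulr_ge0.
apply: eq_eseriesr => s _; rewrite muleC -(Y_mean s.+1 t).
apply: (@expectation_indep _ _ _ _ _ _ dmeas_noise noise_indep (before t)
  (inr (Posz s.+1, t, j, i, l)) _ (fun w => (N w, N' w))
  (fun x => ((s < x.1) (+) (s < x.2))%N%:R : R) (fun n => n%:R)) => //.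
  by rewrite /before /= ltxx.
apply: (@le_lt_trans _ _ (\int[P]_w 1)); last first.
  by rewrite integral_cst// mul1e ltey_eq fin_num_measure.
apply: ge0_le_integral => //.
  exact: mb.
by move=> w _; rewrite lee_fin; case: (_ (+) _).
Qed.

Notation XP := (fun n t w => picard (U ^~ w) (fun s t j i l => Y s t j i l w) n t).
Notation XL := (fun t w => picard_lim (U ^~ w) (fun s t j i l => Y s t j i l w) t).
Notation rec x := (fun t w => recursion (U ^~ w) (fun s t j i l => Y s t j i l w) (x ^~ w) t).

Lemma dmeas_before_picard n t t' : (t' < t)%R -> @dmeas _ (G (before t)) _ (XP n t').
Proof.
move=> t't; apply: (@dmeas_picard _ _ _ _ _ _ t').
- by move=> s st'; apply: dmeas_U; exact: le_lt_trans t't.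
- by move=> s k j i l kt'; apply: dmeas_Y; exact: le_lt_trans t't.
- exact: lexx.
Qed.

Lemma dmeas_before_picard_lim t t' : (t' < t)%R -> @dmeas _ (G (before t)) _ (XL t').
Proof.
move=> t't; apply: (@dmeas_picard_lim _ _ _ _ _ _ t').
- by move=> s st'; apply: dmeas_U; exact: le_lt_trans t't.
- by move=> s k j i l kt'; apply: dmeas_Y; exact: le_lt_trans t't.
- exact: lexx.
Qed.

Lemma dmeas_XP n t : dmeas (XP n t).
Proof. exact: (@dmeas_picard _ _ _ _ _ _ t). Qed.

Lemma dmeas_XL t : dmeas (XL t).
Proof. exact: (@dmeas_picard_lim _ _ _ _ _ _ t). Qed.

Lemma dmeas_coef (V : measure_display) (S : measurableType V) (x : S -> 'cV[nat]_p) i :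
  dmeas x -> dmeas (fun w => x w i ord0).
Proof. exact: (dmeas_map (fun v : 'cV[nat]_p => v i ord0)). Qed.

Let ltBj (t : int) (j : 'I_q) : (t - (j.+1)%:Z < t)%R.
Proof. by rewrite ltrBlDr ltrDl. Qed.

(** Both sides receive the same [U t], which cancels in the difference; Wald's identity then applies
    to each lag and each coordinate. *)
Lemma expectation_ndist_recursion (x x' : int -> T -> 'cV[nat]_p) t i :
    (forall t', (t' < t)%R -> @dmeas _ (G (before t)) _ (x t')) ->
    (forall t', (t' < t)%R -> @dmeas _ (G (before t)) _ (x' t')) ->
  \int[P]_w ((ndist (rec x t w i ord0) (rec x' t w i ord0))%:R)%:E <=
  \sum_(j < q) \sum_(l < p) (A j i l)%:E *
    \int[P]_w ((ndist (x (t - (j.+1)%:Z)%R w l ord0) (x' (t - (j.+1)%:Z)%R w l ord0))%:R)%:E.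
Proof.
move=> mx mx'.
pose D j l w := ndist
  (thinning (fun s => Y s t j i l w) (x (t - (j.+1)%:Z)%R w l ord0))
  (thinning (fun s => Y s t j i l w) (x' (t - (j.+1)%:Z)%R w l ord0)).
have mthin (z : int -> T -> 'cV[nat]_p) (j : 'I_q) l :
    (forall t', (t' < t)%R -> @dmeas _ (G (before t)) _ (z t')) ->
    dmeas (fun w => thinning (fun s => Y s t j i l w) (z (t - (j.+1)%:Z)%R w l ord0)).
  move=> mz; apply: dmeas_thinning => [s|]; first exact: mY.
  by apply: dmeas_coef; apply: dmeas_coarse; exact: mz.
have mD j l : dmeas (D j l).
  exact: (dmeas_map (fun x => ndist x.1 x.2) (dmeas_pair (mthin x j l mx) (mthin x' j l mx'))).
have mDD j : dmeas (fun w => (\sum_(l < p) D j l w)%N) by exact: dmeas_big.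
apply: (@le_trans _ _ (\int[P]_w ((\sum_(j < q) \sum_(l < p) D j l w)%N%:R : R)%:E)).
  apply: ge0_le_integral => //.
  - apply/measurable_EFinP.
    have mrec (z : int -> T -> 'cV[nat]_p) :
      (forall t', (t' < t)%R -> @dmeas _ (G (before t)) _ (z t')) ->
      dmeas (fun w => rec z t w i ord0).
      move=> mz; apply: dmeas_coef; apply: (@dmeas_recursion _ _ _ _ _ _ t) => // j.
      by apply: dmeas_coarse; exact: mz.
    exact: (dmeas_comp (fun x => (ndist x.1 x.2)%:R : R) (dmeas_pair (mrec x mx) (mrec x' mx'))).
  - by apply/measurable_EFinP; apply: dmeas_comp; exact: dmeas_big.
  move=> w _; rewrite lee_fin ler_nat !recursionE.
  set a := (X in ndist (X + _)%N _); set a' := (X in ndist _ (X + _)%N).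
  apply: (@leq_trans (ndist a a')); first by rewrite /ndist; lia.
  apply: leq_trans (ndist_sum _ _ _) _; apply: leq_sum => j _; exact: ndist_sum.
rewrite expectation_sum//; apply: lee_sum => j _.
rewrite expectation_sum//; apply: lee_sum => l _.
rewrite expectation_ndist_thinning//; apply: dmeas_coef; [exact: mx|exact: mx'].
Qed.

Lemma expectation_recursion (x : int -> T -> 'cV[nat]_p) t i :
    (forall t', (t' < t)%R -> @dmeas _ (G (before t)) _ (x t')) ->
  \int[P]_w ((rec x t w i ord0)%:R)%:E =
  \sum_(j < q) \sum_(l < p) (A j i l)%:E *
    \int[P]_w ((x (t - (j.+1)%:Z)%R w l ord0)%:R)%:E + \int[P]_w ((U t w i ord0)%:R)%:E.
Proof.
move=> mx; under eq_integral do rewrite recursionE.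
have mth j l : dmeas (fun w => thinning (fun s => Y s t j i l w) (x (t - (j.+1)%:Z)%R w l ord0)).
  apply: dmeas_thinning => [s|]; first exact: mY.
  by apply: dmeas_coef; apply: dmeas_coarse; exact: mx.
have mths j : dmeas (fun w => \sum_(l < p)
    thinning (fun s => Y s t j i l w) (x (t - (j.+1)%:Z)%R w l ord0))%N.
  exact: dmeas_big.
rewrite expectationD; [|exact: dmeas_big|exact: dmeas_coef].
congr (_ + _); rewrite expectation_sum//; apply: eq_bigr => j _.
rewrite expectation_sum//; apply: eq_bigr => l _.
(* A thinning is its own distance to the thinning of 0, so the mean is the case [N' = 0] of the
   identity for differences. *)
transitivity (\int[P]_w ((ndist (thinning (fun s => Y s t j i l w) (x (t - (j.+1)%:Z)%R w l ord0))
   (thinning (fun s => Y s t j i l w) 0))%:R : R)%:E).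
  apply: eq_integral => w _; congr ((_%:R)%:E).
  by rewrite [thinning _ 0](_ : _ = 0%N) ?ndist0// /thinning big_geq.
rewrite (@expectation_ndist_thinning t j i l (fun w => x (t - (j.+1)%:Z)%R w l ord0) (fun=> 0%N)).
- by under eq_integral do rewrite ndist0.
- by apply: dmeas_coef; exact: mx.
- exact: dmeas_cst.
Qed.

(** * Mean bounds and almost sure convergence of the iterates *)

Variables (u : 'I_p -> R) (m : R).
Hypothesis u_ge1 : forall i, (1 <= u i)%R.
Hypothesis Au_le : forall i, (\sum_l (\sum_(j < q) A j) i l * u l <= u i - 2^-1)%R.
Hypothesis U_mean_le : forall t i, \int[P]_w ((U t w i ord0)%:R)%:E <= m%:E.

Let m_ge0 (i : 'I_p) : (0 <= m)%R.
Proof.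
rewrite -lee_fin; apply: le_trans (U_mean_le 0 i).
by apply: integral_ge0 => w _; rewrite lee_fin.
Qed.

(** [u] is a supersolution: a bound [c * u l] valid at all lags reproduces itself with a gain of
    [c / 2]. *)
Lemma weighted_sum_le (c : R) i (v : 'I_q -> 'I_p -> \bar R) : (0 <= c)%R ->
  (forall j l, v j l <= (c * u l)%:E) ->
  \sum_(j < q) \sum_(l < p) (A j i l)%:E * v j l <= (c * (u i - 2^-1))%:E.
Proof.
move=> c0 vc.
apply: (@le_trans _ _ (\sum_(j < q) \sum_(l < p) (A j i l * (c * u l))%R%:E)).
  apply: lee_sum => j _; apply: lee_sum => l _.
  by rewrite EFinM lee_wpmul2l// lee_fin A_ge0.
under eq_bigr do rewrite sumEFin; rewrite sumEFin lee_fin.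
apply: le_trans (ler_wpM2l c0 (Au_le i)).
rewrite exchange_big/= mulr_sumr; apply: ler_sum => l _.
rewrite summxE mulr_suml mulr_sumr; apply: ler_sum => j _.
by rewrite mulrCA.
Qed.

Lemma picard_mean_le n t i : \int[P]_w ((XP n t w i ord0)%:R)%:E <= (2 * m * u i)%:E.
Proof.
elim: n t i => [|n IH] t i.
  rewrite (eq_integral (cst 0)); last by move=> w _; rewrite mxE.
  rewrite integral0 lee_fin !mulr_ge0// ?(m_ge0 i)//; exact: le_trans (u_ge1 i).
rewrite (@expectation_recursion (XP n)); last by move=> t' t't; exact: dmeas_before_picard.
(* The factor 2 makes the gain, half of [2 * m], pay exactly for the bound [m] on the mean of
   [U]. *)
apply: (@le_trans _ _ ((2 * m * (u i - 2^-1))%:E + m%:E)).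
  apply: leeD; last exact: U_mean_le.
  by apply: weighted_sum_le => //; rewrite mulr_ge0// (m_ge0 i).
by rewrite -EFinD lee_fin; lra.
Qed.

Lemma XP_bounded_ae :
  {ae P, forall w, forall t, exists M, forall n i, (XP n t w i ord0 <= M)%N}.
Proof.
have Hti t i : {ae P, forall w, exists M : R, forall n, ((XP n t w i ord0)%:R <= M)%R}.
  apply: (@monotone_bounded_ae _ _ _ _ _ (2 * m * u i)%R) => [n|n w|w n n' nn'|n] //.
  - by apply: dmeas_comp; apply: dmeas_coef; exact: dmeas_XP.
  - by rewrite ler_nat picard_homo.
  - exact: picard_mean_le.
(* The pairs (t, i) are pickled to obtain a single null set for all of them. *)
pose Q k w := if choice.unpickle k is Some (t, i)
  then exists M : R, forall n, ((XP n t w (i : 'I_p) ord0)%:R <= M)%R else True.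
have QP : {ae P, forall w, forall k, Q k w}.
  apply: ae_foralln => k; rewrite /Q; case: choice.unpickle => [[t i]|]; first exact: Hti.
  exact: aeW.
apply: filterS QP => w Hw t.
have Hi i : exists M, forall n, (XP n t w i ord0 <= M)%N.
  have := Hw (choice.pickle (t, i)); rewrite /Q choice.pickleK => -[M HM].
  exists (Num.bound `|M|) => n; rewrite -(ler_nat R) (le_trans (HM n))//.
  by rewrite (le_trans (ler_norm M))// ltW// archi_boundP.
have [M HM] := choice Hi.
exists (\max_i M i)%N => n i; apply: leq_trans (HM i n) _; exact: leq_bigmax.
Qed.

Lemma XL_solution t : {ae P, forall w, XL t w = rec XL t w}.
Proof. by apply: filterS XP_bounded_ae => w Hw; exact: picard_lim_recursion. Qed.

Lemma XL_expectation_le (h : nat -> R) (c : R) t i :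
  (forall n, (0 <= h n)%R) -> {homo h : k n / (k <= n)%N >-> (k <= n)%R} ->
  (forall n, \int[P]_w (h (XP n t w i ord0))%:E <= c%:E) ->
  \int[P]_w (h (XL t w i ord0))%:E <= c%:E.
Proof.
move=> h0 hh hc.
apply: (monotone_expectation_le (f := fun n w => h (XP n t w i ord0))) => //.
- by move=> n; apply: dmeas_comp; apply: dmeas_coef; exact: dmeas_XP.
- by move=> w k n kn; apply: hh; exact: picard_homo.
- by apply: dmeas_comp; apply: dmeas_coef; exact: dmeas_XL.
- move=> w; have [N HN] := picard_lim_le (U ^~ w) (fun s t j i l => Y s t j i l w) t i.
  by exists N; apply: hh; exact: HN.
Qed.

Lemma XL_mean_le t i : \int[P]_w ((XL t w i ord0)%:R)%:E <= (2 * m * u i)%:E.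
Proof.
apply: (XL_expectation_le (h := fun n => n%:R)) => //.
- by move=> k n; rewrite ler_nat.
- by move=> n; exact: picard_mean_le.
Qed.

(** * Uniqueness by contraction *)

Lemma contraction_factor :
  exists k : R, [/\ (0 <= k)%R, (k < 1)%R & forall i, (u i - 2^-1 <= k * u i)%R].
Proof.
pose M := (1 + \sum_i u i)%R.
have uM i : (u i <= M)%R.
  rewrite /M (bigD1 i)//= addrCA lerDl addr_ge0// sumr_ge0// => k _.
  exact: le_trans (u_ge1 k).
have M1 : (1 <= M)%R.
  by rewrite lerDl sumr_ge0// => k _; exact: le_trans (u_ge1 k).
have M0 : (0 < 2 * M)%R by lra.
(* As [u i <= M], removing the fraction 1/(2M) of [u i] removes at most 1/2; [M >= 1] keeps the
   factor nonnegative. *)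
exists (1 - (2 * M)^-1)%R; split.
- by rewrite subr_ge0 invf_le1//; lra.
- by rewrite ltrBlDr ltrDl invr_gt0.
- by move=> i; rewrite mulrBl mul1r lerD2l lerN2 ler_pdivrMl//; have := uM i; lra.
Qed.

(** The bound [c], uniform in time and at most [c * u i] since [u i >= 1], starts the iteration;
    every further use of the recursion multiplies it by the contraction factor. *)
Lemma solution_unique (x x' : int -> T -> 'cV[nat]_p) (c : R) :
  (forall t t', (t' < t)%R -> @dmeas _ (G (before t)) _ (x t')) ->
  (forall t t', (t' < t)%R -> @dmeas _ (G (before t)) _ (x' t')) ->
  (forall t, {ae P, forall w, x t w = rec x t w}) ->
  (forall t, {ae P, forall w, x' t w = rec x' t w}) ->
  (forall t i, \int[P]_w ((ndist (x t w i ord0) (x' t w i ord0))%:R)%:E <= c%:E) ->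
  forall t, {ae P, forall w, x t w = x' t w}.
Proof.
move=> mx mx' ex ex' xc.
pose V t i := \int[P]_w ((ndist (x t w i ord0) (x' t w i ord0))%:R : R)%:E.
have V0 t i : 0 <= V t i by apply: integral_ge0 => w _; rewrite lee_fin.
have mz (z : int -> T -> 'cV[nat]_p) :
    (forall t t', (t' < t)%R -> @dmeas _ (G (before t)) _ (z t')) -> forall t, dmeas (z t).
  by move=> mz t; apply: (dmeas_coarse (mz (t + 1)%R t _)); rewrite ltzD1.
have mrec (z : int -> T -> 'cV[nat]_p) : (forall t, dmeas (z t)) -> forall t, dmeas (rec z t).
  by move=> mz' t; exact: (@dmeas_recursion _ _ _ _ _ _ t).
have mnd (z z' : int -> T -> 'cV[nat]_p) t i : dmeas (z t) -> dmeas (z' t) ->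
    measurable_fun setT (fun w => ((ndist (z t w i ord0) (z' t w i ord0))%:R : R)%:E).
  move=> mzt mzt'; apply/measurable_EFinP.
  exact: (dmeas_comp (fun y => (ndist y.1 y.2)%:R : R)
    (dmeas_pair (dmeas_coef i mzt) (dmeas_coef i mzt'))).
have VA t i : V t i <= \sum_(j < q) \sum_(l < p) (A j i l)%:E * V (t - (j.+1)%:Z)%R l.
  apply: le_trans (expectation_ndist_recursion i (mx t) (mx' t)).
  rewrite le_eqVlt; apply/orP; left; apply/eqP.
  apply: ge0_ae_eq_integral => //; try by move=> w _; rewrite lee_fin.
  - by apply: mnd; exact: mz.
  - by apply: (mnd (rec x) (rec x')); apply: mrec; exact: mz.
  by apply: filterS2 (ex t) (ex' t) => w <- <-.
(* Vectors without coordinates are equal; a coordinate yields [c >= 0], since [c] bounds a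
   nonnegative mean. *)
have [[i0 _]|noi] := pselect (exists i : 'I_p, True); last first.
  by move=> t; apply: aeW => w; apply/colP => i; exfalso; apply: noi; exists i.
have c0 : (0 <= c)%R by rewrite -lee_fin (le_trans (V0 (Posz 0) i0) (xc _ _)).
have [k [k0 k1 uk]] := contraction_factor.
have Vk n t i : V t i <= (c * k ^+ n * u i)%:E.
  elim: n t i => [|n IH] t i.
    by rewrite expr0 mulr1 (le_trans (xc t i))// lee_fin ler_peMr.
  apply: le_trans (VA t i) _.
  apply: le_trans (weighted_sum_le (c := (c * k ^+ n)%R) i _ _) _ => //.
    by rewrite mulr_ge0// exprn_ge0.
  rewrite lee_fin exprSr mulrA -[leRHS]mulrA ler_wpM2l// mulr_ge0// exprn_ge0//.
have V_eq0 t i : V t i = 0.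
  apply/eqP; rewrite eq_le V0 andbT.
  apply/lee_addgt0Pr => e e0; rewrite add0e.
  have cv : ((c * u i * k ^+ n)%R @[n --> \oo] --> (c * u i * 0)%R)%classic.
    by apply: cvgM; [exact: cvg_cst|apply: cvg_expr; rewrite ger0_norm].
  have [N _ HN] : \forall n \near \oo, (c * u i * k ^+ n < e)%R.
    by apply: (cvgr_lt _ cv); rewrite mulr0.
  have /= := HN N (leqnn N); rewrite mulrAC => /ltW cke.
  by apply: le_trans (Vk N t i) _; rewrite lee_fin.
move=> t.
have Hi i : {ae P, forall w, x t w i ord0 = x' t w i ord0}.
  have mi := mnd x x' t i (mz x mx t) (mz x' mx' t).
  have := (ae_eq_integral_abs P measurableT mi).1.
  have -> : \int[P]_w `|((ndist (x t w i ord0) (x' t w i ord0))%:R : R)%:E| = 0.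
    by rewrite -(V_eq0 t i); apply: eq_integral => w _; rewrite gee0_abs// lee_fin.
  move=> /(_ erefl); apply: filterS => w /(_ I) [] /eqP.
  by rewrite pnatr_eq0 /ndist => /eqP; lia.
apply: filterS (filter_forall _ Hi) => w Hw.
by apply/colP => i; exact: Hw.
Qed.

(** * Stationarity of the limit *)

Definition noise_shift (h : int) (k : noise_index) : noise_index :=
  match k with
  | inl t => inl (t + h)%R
  | inr (s, t, j, i, l) => inr (s, t + h, j, i, l)%R
  end.

Lemma noise_shiftK h : cancel (noise_shift h) (noise_shift (- h)).
Proof. by move=> [t|[[[[s t] j] i] l]] /=; rewrite addrK. Qed.

Hypothesis noise_law : forall h k B,
  P (noise (noise_shift h k) @^-1` B) = P (noise k @^-1` B).

(** Independence reduces the probability of a cylinder to those of events on single variables, which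
    the shift preserves. *)
Lemma cylinder_noise_shift h J B :
  P (cylinder (noise \o noise_shift h) J B) = P (cylinder noise J B).
Proof.
have inj : injective (noise_shift h) := can_inj (noise_shiftK h).
have -> : cylinder (noise \o noise_shift h) J B =
    cylinder noise [fset noise_shift h k | k in J]%fset (fun k => B (noise_shift (- h) k)).
  apply/seteqP; split=> w /= Hw k /=.
    by move=> /imfsetP[k' /= k'J ->]; rewrite noise_shiftK; exact: Hw.
  move=> kJ; have := Hw (noise_shift h k); rewrite noise_shiftK; apply.
  by rewrite /= mem_imfset.
rewrite !noise_indep big_imfset/=; last by move=> ? ? _ _; exact: inj.
by apply: eq_bigr => k _; rewrite noise_shiftK noise_law.
Qed.

Lemma XL_stationary (n : nat) (t : 'I_n -> int) (h : int) (B : set ('I_n -> 'cV[nat]_p)) :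
  P [set w | B (fun k => XL (t k + h)%R w)] = P [set w | B (fun k => XL (t k) w)].
Proof.
(* The limit as a function of a path [e] of the coded noise; numbers that code no vector are read as
   0. *)
pose Lim (e : noise_index -> nat) s := picard_lim
  (fun t => odflt (0 : 'cV[nat]_p)%R (choice.unpickle (e (inl t))))
  (fun s t j i l => e (inr (s, t, j, i, l))) s.
pose C := [set e : noise_index -> nat | B (fun k => Lim e (t k))].
have HC : <<s coord_sets (fun k (e : noise_index -> nat) => e k) setT >> C.
  pose S := g_sigma_algebraType (coord_sets (fun k (e : noise_index -> nat) => e k) setT).
  have coordS k : @dmeas _ S _ (fun e => e k).
    by move=> E; apply: sub_sigma_algebra; exists k => //; exists E.
  have mLim s : @dmeas _ S _ (fun e => Lim e s).
    apply: (@dmeas_picard_lim p q _ S _ _ s) => // ? _.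
    exact: (dmeas_map (fun n => odflt (0 : 'cV[nat]_p)%R (choice.unpickle n))).
  (* The limits are packed into a finite function, whose type is a [countType], so that singletons
     suffice. *)
  have mF : @dmeas _ S _ (fun e => [ffun k : 'I_n => Lim e (t k)]).
    apply: (@dmeas_singleton _ S {ffun 'I_n -> 'cV[nat]_p}) => f.
    rewrite [X in measurable X](_ : _ =
        \bigcap_(k in [set: 'I_n]) (fun e => Lim e (t k)) @^-1` [set f k]).
      by apply: fin_bigcap_measurable => // k _; exact: mLim.
    apply/seteqP; split=> e /=; first by move=> <- k _ /=; rewrite ffunE.
    by move=> He; apply/ffunP => k; rewrite ffunE; exact: He.
  have := mF [set f | B (fun k => f k)].
  rewrite [X in measurable X](_ : _ = C)//.
  by apply/seteqP; split=> e; rewrite /C /=;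
    (rewrite (_ : (fun k => [ffun k => Lim e (t k)] k) = fun k => Lim e (t k));
     last by apply/funext => k; rewrite ffunE).
have := @law_unique _ _ _ P _ _ _ (fun k => dmeas_noise (noise_shift h k))
  dmeas_noise (cylinder_noise_shift h) C HC.
have -> : [set w | C ((noise \o noise_shift h) ^~ w)] =
    [set w | B (fun k => XL (t k + h)%R w)].
  congr (fun D => [set w | D w]); apply/funext => w; rewrite /C /=; congr B.
  apply/funext => k; rewrite /Lim /= -picard_lim_shift; congr picard_lim.
  by apply/funext => s; rewrite choice.pickleK.
have -> // : [set w | C (noise ^~ w)] = [set w | B (fun k => XL (t k) w)].
congr (fun D => [set w | D w]); apply/funext => w; rewrite /C /=; congr B.
apply/funext => k; rewrite /Lim /=; congr picard_lim.
by apply/funext => s; rewrite choice.pickleK.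
Qed.

(** * Moments of order [r] *)

Lemma thinning_integral_le (y : int -> T -> nat) (X : T -> nat) (H H' : T -> R) :
    (forall s, dmeas (y s)) -> dmeas X ->
    measurable_fun setT H -> measurable_fun setT H' ->
    (forall w, (0 <= H w)%R) -> (forall w, (0 <= H' w)%R) ->
    (forall s, \int[P]_w ((s < X w)%N%:R * ((y s.+1 w)%:R * H w))%:E <=
               \int[P]_w ((s < X w)%N%:R * H' w)%:E) ->
  \int[P]_w ((thinning (y ^~ w) (X w))%:R * H w)%:E <= \int[P]_w ((X w)%:R * H' w)%:E.
Proof.
move=> my mX mH mH' H0 H0' Hs.
have mlt s : measurable_fun setT (fun w => (s < X w)%N%:R : R).
  exact: (dmeas_comp (fun n => (s < n)%N%:R : R) mX).
(* Both integrals are expanded over the offspring index [s], the right one by writing [X] as the sum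
   of the indicators of [s < X]; the hypothesis compares them term by term. *)
have E1 : \int[P]_w ((thinning (y ^~ w) (X w))%:R * H w)%:E =
    \sum_(s <oo) \int[P]_w ((s < X w)%N%:R * ((y s.+1 w)%:R * H w))%:E.
  rewrite -integral_nneseries//.
  - apply: eq_integral => w _; rewrite (@eseries_finite _ _ (X w)); last first.
      by move=> n Xn; rewrite ltnNge Xn mul0r.
    rewrite (thinning_sum _ (leqnn (X w))) natr_sum mulr_suml sumEFin.
    by congr EFin; apply: eq_bigr => s _; rewrite natrM mulrA.
  - move=> s; apply/measurable_EFinP; apply: measurable_funM; first exact: mlt.
    by apply: measurable_funM => //; apply: (dmeas_comp (fun n => n%:R : R)).
  - by move=> s w _; rewrite lee_fin !mulr_ge0.
have E2 : \int[P]_w ((X w)%:R * H' w)%:E = \sum_(s <oo) \int[P]_w ((s < X w)%N%:R * H' w)%:E.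
  rewrite -integral_nneseries//.
  - apply: eq_integral => w _; rewrite (@eseries_finite _ _ (X w)); last first.
      by move=> n Xn; rewrite ltnNge Xn mul0r.
    rewrite -{1}[X w]ndist0 (ndist_count (leqnn _) (leq0n _)) natr_sum mulr_suml sumEFin.
    by congr EFin; apply: eq_bigr => s _; rewrite addbF.
  - by move=> s; apply/measurable_EFinP; apply: measurable_funM.
  - by move=> s w _; rewrite lee_fin mulr_ge0.
rewrite E1 E2; apply: lee_nneseries => [s *|s *]; last exact: Hs.
by apply: integral_ge0 => w _; rewrite lee_fin !mulr_ge0.
Qed.

Lemma dmeas_subset D D' (V : Type) (f : T -> V) : D `<=` D' ->
  @dmeas _ (G D) _ f -> @dmeas _ (G D') _ f.
Proof.
move=> DD' mf B; have := mf B; apply: sub_sigma_algebra2.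
by move=> _ [k Dk [E ->]]; exists k; [exact: DD'|exists E].
Qed.

Section moments.
Variables (r mr : R).
Hypothesis r_gt1 : (1 < r)%R.
Hypothesis mr_ge0 : (0 <= mr)%R.
Hypothesis Y_moment : forall s t j i l, \int[P]_w ((Y s t j i l w)%:R `^ r)%:E <= mr%:E.
Hypothesis U_moment : forall t i, \int[P]_w ((U t w i ord0)%:R `^ r)%:E <= mr%:E.

Let r1_gt0 : (0 < r - 1)%R. Proof. by rewrite subr_gt0. Qed.

Let child n t i w := rec (XP n) t w i ord0.
Let parent n t (j : 'I_q) l w := XP n (t - (j.+1)%:Z)%R w l ord0.

(* Removing the single variable [Y s t j i l] from the sum [S] decouples it from
   the weight [min S K `^ (r - 1)]. *)
Lemma decoupled_term_le (e C : R) (n : nat) (t : int) (i : 'I_p) (K : nat) (j : 'I_q)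
    (l : 'I_p) (s : nat) : (0 <= e)%R -> (0 <= C)%R ->
  (forall x y : R, (0 <= x)%R -> (0 <= y)%R ->
    ((x + y) `^ (r - 1) <= (1 + e) * x `^ (r - 1) + C * y `^ (r - 1))%R) ->
  \int[P]_w ((s < parent n t j l w)%N%:R *
      ((Y s.+1 t j i l w)%:R * (minn (child n t i w) K)%:R `^ (r - 1)))%:E
  <= \int[P]_w ((s < parent n t j l w)%N%:R *
       ((1 + e) * A j i l * (minn (child n t i w) K)%:R `^ (r - 1) + C * mr))%:E.
Proof.
move=> e0 C0 He; pose S := child n t i; pose X := parent n t j l.
rewrite -/S -/X.
pose k : noise_index := inr (Posz s.+1, t, j, i, l).
(* [Y'] is the offspring family with the variable of index [k] set to 0, and [S'] the resulting sum;
   [X] and [S'] involve only the noise with index in [D], that is, other than [k]. *)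
pose Y' s' t' j' i' l' := if inr (s', t', j', i', l') == k then fun=> 0%N
                          else Y s' t' j' i' l'.
pose D := [set k' | k' != k].
pose S' w := recursion (U ^~ w) (fun s t j i l => Y' s t j i l w) (XP n ^~ w) t i ord0.
have bD : before t `<=` D.
  by move=> k' /=; rewrite /before /D /= => k't; apply/eqP => E; move: k't; rewrite E /= ltxx.
have mX : @dmeas _ (G D) _ X.
  by apply: dmeas_coef; apply: (dmeas_subset bD); exact: dmeas_before_picard.
have mS' : @dmeas _ (G D) _ S'.
  apply: dmeas_coef; apply: (@dmeas_recursion p q _ (G D) U Y' t) => //.
  - by move=> t' _; exact: dmeas_U.
  - move=> s' t' j' i' l' _; rewrite /Y'; case: eqP => [_|/eqP k'k]; first exact: dmeas_cst.
    exact: dmeas_Y.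
  - by move=> j'; apply: (dmeas_subset bD); exact: dmeas_before_picard.
have mXS : @dmeas _ (G D) _ (fun w => (X w, S' w)) by exact: dmeas_pair.
have S'S w : (S' w <= S w)%N.
  rewrite /S' /S /child !recursionE leq_add2r; apply: leq_sum => j' _; apply: leq_sum => l' _.
  apply: leq_sum => s' _; rewrite /Y'; by case: eqP.
have SS' w : (S w <= S' w + Y s.+1 t j i l w)%N.
  rewrite /S' /S /child !recursionE addnAC leq_add2r.
  rewrite (bigD1 j)//= [in leqRHS](bigD1 j)//=.
  rewrite (bigD1 l)//= [in leqRHS](bigD1 l)//=.
  have thinE (j' : 'I_q) (l' : 'I_p) : (j', l') != (j, l) ->
     thinning (fun s0 => Y' s0 t j' i l' w) (XP n (t - (j'.+1)%:Z)%R w l' ord0) =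
     thinning (fun s0 => Y s0 t j' i l' w) (XP n (t - (j'.+1)%:Z)%R w l' ord0).
    move=> jl; apply: eq_bigr => s' _; rewrite /Y'; case: eqP => // -[_ jj ll].
    by move: jl; rewrite jj ll eqxx.
  rewrite [X in (_ + X + _ <= _)%N](_ : _ =
     \sum_(l' < p | l' != l) thinning (fun s0 => Y' s0 t j i l' w)
       (XP n (t - (j.+1)%:Z)%R w l' ord0))%N; last first.
    by apply: eq_bigr => l' l'l; rewrite thinE// xpair_eqE eqxx.
  rewrite [X in (_ + X <= _)%N](_ : _ = \sum_(j' < q | j' != j) \sum_(l' < p)
     thinning (fun s0 => Y' s0 t j' i l' w)
       (XP n (t - (j'.+1)%:Z)%R w l' ord0))%N; last first.
    apply: eq_bigr => j' j'j; apply: eq_bigr => l' _; rewrite thinE// xpair_eqE.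
    by rewrite (negbTE j'j).
  rewrite [leqRHS]addnAC leq_add2r [leqRHS]addnAC leq_add2r.
  (* Restoring the removed variable adds at most its value, and only if [s.+1 <= M]. *)
  have thinD M : (thinning (fun s0 => Y s0 t j i l w) M <=
      thinning (fun s0 => Y' s0 t j i l w) M + (s.+1 <= M)%N * Y s.+1 t j i l w)%N.
    have thinS (z : int -> nat) N : thinning z N.+1 = (thinning z N + z N.+1)%N.
      by rewrite /thinning big_nat_recr.
    elim: M => [|M IH]; first by rewrite /thinning big_geq.
    rewrite !thinS; case: (eqVneq M s) IH => [->|Ms] IH.
      have -> : Y' s.+1 t j i l w = 0%N by rewrite /Y' /k eqxx.
      by move: IH; rewrite ltnn leqnn mul0n mul1n; lia.
    have -> : Y' M.+1 t j i l w = Y M.+1 t j i l w.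
      by rewrite /Y'; case: eqP => // -[E]; move: Ms; rewrite E eqxx.
    move: IH; case: (ltnP s M) => sM; [have -> : (s < M.+1)%N by lia|
      have -> : (s < M.+1)%N = false by lia]; rewrite ?mul1n ?mul0n; lia.
  apply: leq_trans (thinD _) _; rewrite leq_add2l.
  by case: leqP => _; rewrite ?mul1n ?mul0n.
pose W w : R := (minn (S w) K)%:R.
pose W' w : R := (minn (S' w) K)%:R.
have W'W w : (W' w `^ (r - 1) <= W w `^ (r - 1))%R.
  apply: ge0_ler_powR; rewrite ?nnegrE ?ler0n ?(ltW r1_gt0)//.
  by rewrite ler_nat; have := S'S w; lia.
have WW' w : (W w `^ (r - 1) <= (1 + e) * W' w `^ (r - 1) + C * (Y s.+1 t j i l w)%:R `^ (r - 1))%R.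
  apply: le_trans (He (W' w) (Y s.+1 t j i l w)%:R _ _) => //.
  apply: ge0_ler_powR; rewrite ?nnegrE ?(ltW r1_gt0) ?addr_ge0 ?ler0n//.
  by rewrite /W /W' -natrD ler_nat; have := SS' w; lia.
pose h1 (x : nat * nat) : R := ((s < x.1)%N%:R * (minn x.2 K)%:R `^ (r - 1))%R.
pose h2 (x : nat * nat) : R := ((s < x.1)%N%:R)%R.
have h1_ge0 x : (0 <= h1 x)%R by rewrite mulr_ge0 ?powR_ge0.
have mXS' := dmeas_coarse mXS.
have mS : dmeas S by apply: dmeas_coef; exact: (dmeas_XP n.+1).
have mY1 := mY s.+1 t j i l.
have mX' := dmeas_coarse mX.
have mh1 : measurable_fun setT (fun w => h1 (X w, S' w)) by exact: (dmeas_comp h1 mXS').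
have mh2 : measurable_fun setT (fun w => h2 (X w, S' w)) by exact: (dmeas_comp h2 mXS').
have mYr (b : R) : measurable_fun setT (fun w => (Y s.+1 t j i l w)%:R `^ b : R)%R.
  exact: (dmeas_comp (fun y => y%:R `^ b : R)%R).
have mYn : measurable_fun setT (fun w => (Y s.+1 t j i l w)%:R : R).
  exact: (dmeas_comp (fun y => y%:R : R)).
have mM (f g : T -> R) : measurable_fun setT f -> measurable_fun setT g ->
    measurable_fun setT (fun w => f w * g w)%R.
  exact: measurable_funM.
have bounded_lty (f : T -> R) (c : R) : measurable_fun setT f ->
    (forall w, (0 <= f w)%R) -> (forall w, (f w <= c)%R) -> \int[P]_w (f w)%:E < +oo.
  move=> mf f0 fc; apply: (@le_lt_trans _ _ (\int[P]_w c%:E)).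
    apply: ge0_le_integral => //; first by move=> w _; rewrite lee_fin.
    - exact/measurable_EFinP.
    - by move=> w _; rewrite lee_fin.
  by rewrite integral_cst// ltey_eq fin_numM// fin_num_measure.
have indep (h : nat * nat -> R) (g : nat -> R) :
    (forall x, (0 <= h x)%R) -> (forall y, (0 <= g y)%R) ->
    \int[P]_w (h (X w, S' w))%:E < +oo ->
    \int[P]_w (h (X w, S' w) * g (Y s.+1 t j i l w))%:E =
    \int[P]_w (h (X w, S' w))%:E * \int[P]_w (g (Y s.+1 t j i l w))%:E.
  move=> h0 g0 hoo.
  apply: (@expectation_indep _ _ _ _ _ _ dmeas_noise noise_indep D k _ (fun w => (X w, S' w))) => //.
  by rewrite /D /= eqxx.
(* Bounding [W] through [W'] splits the integrand in two, with Y Y^(r-1) = Y^r in the second part.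
   Each part is a function of [X] and [S'] times a function of the variable independent of them. *)
apply: (@le_trans _ _ (\int[P]_w
   ((1 + e) * (h1 (X w, S' w) * (Y s.+1 t j i l w)%:R) +
    C * (h2 (X w, S' w) * (Y s.+1 t j i l w)%:R `^ r))%:E)).
  apply: ge0_le_integral => //.
  - apply/measurable_EFinP; exact: (dmeas_comp (fun x => (s < x.1.1)%N%:R *
      (x.1.2%:R * (minn x.2 K)%:R `^ (r - 1)) : R)%R (dmeas_pair (dmeas_pair mX' mY1) mS)).
  - apply/measurable_EFinP; exact: (dmeas_comp (fun x => (1 + e) * (h1 x.1 * x.2%:R) +
      C * (h2 x.1 * x.2%:R `^ r) : R)%R (dmeas_pair mXS' mY1)).
  - move=> w _; rewrite lee_fin /h1 /h2 /= -/(W' w).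
    have y0 : (0 <= (Y s.+1 t j i l w)%:R :> R)%R by [].
    rewrite -(mulr_powRB1 y0 (lt_trans ltr01 r_gt1)).
    rewrite [leRHS](_ : _ = ((s < X w)%N%:R * ((Y s.+1 t j i l w)%:R *
      ((1 + e) * W' w `^ (r - 1) + C * (Y s.+1 t j i l w)%:R `^ (r - 1))))%R); last by ring.
    by rewrite ler_wpM2l// ler_wpM2l//; exact: WW'.
have intD (f g : T -> R) : measurable_fun setT f -> measurable_fun setT g ->
    (forall w, (0 <= f w)%R) -> (forall w, (0 <= g w)%R) ->
    \int[P]_w (f w + g w)%:E = \int[P]_w (f w)%:E + \int[P]_w (g w)%:E.
  move=> mf mg f0 g0; under eq_integral do rewrite EFinD.
  by rewrite ge0_integralD//; (try exact/measurable_EFinP); move=> w _; rewrite lee_fin.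
have intZ (c : R) (f : T -> R) : (0 <= c)%R -> measurable_fun setT f -> (forall w, (0 <= f w)%R) ->
    \int[P]_w (c * f w)%:E = c%:E * \int[P]_w (f w)%:E.
  move=> c0 mf f0; under eq_integral do rewrite EFinM.
  by rewrite ge0_integralZl_EFin//; (try exact/measurable_EFinP); move=> w _; rewrite lee_fin.
have e1 : (0 <= 1 + e)%R by rewrite addr_ge0.
(* The truncation at [K] provides the finiteness required by the product formula. *)
have h1oo : \int[P]_w (h1 (X w, S' w))%:E < +oo.
  apply: (bounded_lty _ (K%:R `^ (r - 1))%R) => // w.
  rewrite /h1 /= -[leRHS]mul1r ler_pM ?powR_ge0//; first by case: (_ < _)%N.
  by apply: ge0_ler_powR; rewrite ?nnegrE ?(ltW r1_gt0)// ler_nat geq_minr.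
have h2oo : \int[P]_w (h2 (X w, S' w))%:E < +oo.
  by apply: (bounded_lty _ 1%R) => // w; rewrite /h2 /=; case: (_ < _)%N.
rewrite intD; last 4 first.
- by apply: (mM) => //; exact: mM.
- by apply: (mM) => //; exact: mM.
- by move=> w; rewrite !mulr_ge0.
- by move=> w; rewrite !mulr_ge0 ?powR_ge0.
rewrite !intZ//; last 4 first.
- exact: mM.
- by move=> w; rewrite !mulr_ge0 ?powR_ge0.
- exact: mM.
- by move=> w; rewrite !mulr_ge0 ?powR_ge0.
rewrite (indep h1 (fun y => y%:R))// (indep h2 (fun y => y%:R `^ r)%R)//.
rewrite Y_mean.
apply: (@le_trans _ _ (\int[P]_w ((1 + e) * A j i l * h1 (X w, S' w) + C * mr * h2 (X w, S' w))%:E)).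
  rewrite intD; last 4 first.
  - exact: mM.
  - exact: mM.
  - by move=> w; rewrite !mulr_ge0// A_ge0.
  - by move=> w; rewrite !mulr_ge0.
  rewrite !intZ//; last 2 first.
  - by rewrite mulr_ge0.
  - by rewrite mulr_ge0// A_ge0.
  apply: leeD; first by rewrite [X in _ * X <= _]muleC muleA -EFinM.
  rewrite EFinM -muleA lee_wpmul2l// [leRHS]muleC lee_wpmul2l//.
  by apply: integral_ge0 => w _; rewrite lee_fin.
(* The monotonicity [W' <= W] brings back the full sum. *)
apply: ge0_le_integral => //.
- by move=> w _; rewrite lee_fin addr_ge0// !mulr_ge0// A_ge0.
- apply/measurable_EFinP; exact: (dmeas_comp
    (fun x => (1 + e) * A j i l * h1 x + C * mr * h2 x : R)%R mXS').
- apply/measurable_EFinP.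
  exact: (dmeas_comp (fun x => (s < x.1)%N%:R *
      ((1 + e) * A j i l * (minn x.2 K)%:R `^ (r - 1) + C * mr) : R)%R
    (dmeas_pair mX' mS)).
- move=> w _; rewrite lee_fin /h1 /h2 /= mulrDr -/(W w) -/(W' w) [(C * mr * _)%R]mulrC lerD2r.
  by rewrite mulrCA ler_wpM2l// ler_wpM2l// mulr_ge0// A_ge0.
Qed.

(** [y], finite by truncation, occurs on both sides, and can be absorbed once its coefficient
    [a + (1 + e) * k * (1 - r^-1)] is below 1. Here [a] is the weight in Young's inequality for the
    term [U], and [z] comes from the bound on the iterate [n]. *)
Lemma truncated_moment_le (k e C a z : R) (n : nat) (t : int) (i : 'I_p) (K : nat) :
  (0 <= e)%R -> (0 <= C)%R -> (0 < a)%R -> (0 <= z)%R ->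
  (forall l, (u l - 2^-1 <= k * u l)%R) ->
  (forall x y : R, (0 <= x)%R -> (0 <= y)%R ->
    ((x + y) `^ (r - 1) <= (1 + e) * x `^ (r - 1) + C * y `^ (r - 1))%R) ->
  (forall t l, \int[P]_w ((XP n t w l ord0)%:R `^ r)%:E <= (z * u l `^ r)%:E) ->
  exists2 y : R,
    \int[P]_w ((child n t i w)%:R * (minn (child n t i w) K)%:R `^ (r - 1))%:E = y%:E &
    (0 <= y)%R /\
    (y <= (a `^ (- (r - 1)) * mr + a * y) +
     ((1 + e) * k * (z * u i `^ r / r + (1 - r^-1) * y) +
      C * mr * (2 * m) * (q%:R * \sum_l u l)))%R.
Proof.
move=> e0 C0 a0 z0 uk HC IH.
have u_gt0 l : (0 < u l)%R := lt_le_trans ltr01 (u_ge1 l).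
have r0 : (0 < r)%R := lt_trans ltr01 r_gt1.
have ri1 : (r^-1 <= 1)%R by rewrite invf_le1// ltW.
have m0 : (0 <= 2 * m)%R by rewrite mulr_ge0// (m_ge0 i).
pose S := child n t i.
pose Wb w : R := ((minn (S w) K)%:R `^ (r - 1))%R.
have mS : dmeas S by apply: dmeas_coef; exact: (dmeas_XP n.+1).
have mWb : measurable_fun setT Wb.
  exact: (dmeas_comp (fun x => (minn x K)%:R `^ (r - 1) : R)%R mS).
have Wb0 w : (0 <= Wb w)%R by exact: powR_ge0.
have mSW : measurable_fun setT (fun w => (S w)%:R * Wb w)%R.
  exact: (dmeas_comp (fun x => x%:R * (minn x K)%:R `^ (r - 1) : R)%R mS).
have SW0 w : (0 <= (S w)%:R * Wb w)%R by rewrite mulr_ge0.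
have mS1 : measurable_fun setT (fun w => (S w)%:R : R) by exact: (dmeas_comp (fun x => x%:R : R) mS).
have yfin : \int[P]_w ((S w)%:R * Wb w)%:E <= (K%:R `^ (r - 1) * (2 * m * u i) + 0 * (2 * m * u i))%:E.
  apply: le_trans (expectation_lin_le (f := fun w => (S w)%:R) (g := fun w => (S w)%:R)
    mS1 mS1 _ _ _ _ (picard_mean_le n.+1 t i) (picard_mean_le n.+1 t i)) => //.
  apply: expectation_le => //.
    exact: (dmeas_comp (fun x => K%:R `^ (r - 1) * x%:R + 0 * x%:R : R)%R mS).
  move=> w; rewrite mul0r addr0 mulrC ler_wpM2r//.
  by apply: ge0_ler_powR; rewrite ?nnegrE ?(ltW r1_gt0)// ler_nat geq_minr.
have y0 : 0 <= \int[P]_w ((S w)%:R * Wb w)%:E by apply: integral_ge0 => w _; rewrite lee_fin.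
have [y yE] : exists y, \int[P]_w ((S w)%:R * Wb w)%:E = y%:E.
  exists (fine (\int[P]_w ((S w)%:R * Wb w)%:E)); rewrite fineK// ge0_fin_numE//.
  by apply: le_lt_trans yfin _; exact: ltry.
exists y => //; move: y0; rewrite yE lee_fin => y0; split => //.
rewrite -lee_fin -{1}yE.
have ySW : \int[P]_w ((S w)%:R * Wb w)%:E <= y%:E by rewrite yE.
(* Through this bound the term w^r of Young's inequality is controlled by [y]. *)
have Wr w : ((minn (S w) K)%:R `^ r <= (S w)%:R * Wb w)%R.
  rewrite -(@mulr_powRB1 _ (minn (S w) K)%:R r)// /Wb ler_wpM2r// ?powR_ge0//.
  by rewrite ler_nat geq_minl.
pose th j l w : nat := thinning (fun s => Y s t j i l w) (parent n t j l w).
pose Ui w : nat := U t w i ord0.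
have mpar j l : dmeas (parent n t j l) by apply: dmeas_coef; exact: dmeas_XP.
have mth j l : dmeas (th j l) by apply: dmeas_thinning => // s; exact: mY.
have mUi : dmeas Ui by exact: dmeas_coef.
have mnat (N : T -> nat) : dmeas N -> measurable_fun setT (fun w => (N w)%:R * Wb w)%R.
  move=> mN; exact: (dmeas_comp (fun x => x.1%:R * (minn x.2 K)%:R `^ (r - 1) : R)%R (dmeas_pair mN mS)).
have SE w : ((S w)%:R * Wb w =
    1 * ((Ui w)%:R * Wb w) + 1 * \sum_(j < q) \sum_(l < p) (th j l w)%:R * Wb w)%R.
  rewrite !mul1r {1}/S /child recursionE addnC natrD mulrDl; congr (_ + _)%R.
  rewrite natr_sum mulr_suml; apply: eq_bigr => j _.
  by rewrite natr_sum mulr_suml.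
under eq_integral do rewrite SE.
rewrite -[X in (X + _)%R]mul1r -[X in (_ + X)%R]mul1r.
have mthW j l : measurable_fun setT (fun w => (th j l w)%:R * Wb w)%R by exact: mnat.
have msum : measurable_fun setT (fun w => \sum_(j < q) \sum_(l < p) (th j l w)%:R * Wb w)%R.
  by apply: measurable_sum => j; apply: measurable_sum => l.
apply: expectation_lin_le => //.
- exact: mnat.
- by move=> w; rewrite mulr_ge0.
- by move=> w; apply: sumr_ge0 => j _; apply: sumr_ge0 => l _; rewrite mulr_ge0.
- apply: (@le_trans _ _ (\int[P]_w (a `^ (- (r - 1)) * (Ui w)%:R `^ r + a * ((S w)%:R * Wb w))%:E)).
    apply: expectation_le.
    + exact: mnat.
    + exact: (dmeas_comp (fun x => a `^ (- (r - 1)) * x.1%:R `^ r + a * (x.2%:R *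
        (minn x.2 K)%:R `^ (r - 1)) : R)%R (dmeas_pair mUi mS)).
    + by move=> w; rewrite mulr_ge0.
    + move=> w; apply: le_trans (young_powR r_gt1 a0 (ler0n _ _) (ler0n _ _)) _.
      apply: lerD.
        by rewrite ler_piMr// mulr_ge0// powR_ge0.
      apply: ler_pM; rewrite ?powR_ge0//.
        by rewrite mulr_ge0 ?subr_ge0// ltW.
      by rewrite ger_pMr// gerBl invr_ge0 ltW.
  apply: expectation_lin_le => //.
  + exact: (dmeas_comp (fun x => x%:R `^ r : R)%R mUi).
  + exact: powR_ge0.
  + exact: ltW.
  + exact: U_moment.
have -> : \int[P]_w (\sum_(j < q) \sum_(l < p) (th j l w)%:R * Wb w)%R%:E =
    \sum_(j < q) \sum_(l < p) \int[P]_w ((th j l w)%:R * Wb w)%:E.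
  under eq_integral do rewrite -sumEFin.
  rewrite ge0_integral_sum//; last 2 first.
  - by move=> j; apply/measurable_EFinP; apply: measurable_sum => l.
  - by move=> j w _; rewrite lee_fin sumr_ge0// => l _; rewrite mulr_ge0.
  apply: eq_bigr => j _; under eq_integral do rewrite -sumEFin.
  rewrite ge0_integral_sum//.
  - by move=> l; exact/measurable_EFinP.
  - by move=> l w _; rewrite lee_fin mulr_ge0.
pose bd := (z * u i `^ r / r + (1 - r^-1) * y)%R.
have bd0 : (0 <= bd)%R.
  by rewrite addr_ge0// ?mulr_ge0 ?powR_ge0 ?invr_ge0 ?subr_ge0// ltW.
have term_le j l : \int[P]_w ((th j l w)%:R * Wb w)%:E <=
    ((1 + e) * A j i l * (u l / u i) * bd + C * mr * (2 * m * u l))%:E.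
  apply: (@le_trans _ _ (\int[P]_w ((parent n t j l w)%:R *
       ((1 + e) * A j i l * Wb w + C * mr))%:E)).
    apply: (@thinning_integral_le (fun s => Y s t j i l)) => //.
    - exact: (dmeas_comp (fun x => (1 + e) * A j i l * (minn x K)%:R `^ (r - 1) + C * mr : R)%R mS).
    - by move=> w; rewrite addr_ge0// !mulr_ge0 ?addr_ge0 ?A_ge0.
    - by move=> s; exact: decoupled_term_le.
  (* With this weight both terms of Young's inequality become multiples of [la], because la^(-(r-1))
     u_l^r = la u_i^r. *)
  pose la := (u l / u i)%R.
  have la0 : (0 < la)%R by rewrite divr_gt0.
  have laE : (la `^ (- (r - 1)) * u l `^ r = la * u i `^ r)%R.
    have -> : u l = (la * u i)%R by rewrite /la divfK// gt_eqF.
    rewrite powRM ?ltW// mulrA -powRD; last by rewrite (gt_eqF la0) implybT.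
    by rewrite (_ : - (r - 1) + r = 1)%R ?powRr1 ?ltW//; ring.
  have X_le : \int[P]_w ((parent n t j l w)%:R * Wb w)%:E <= (la * bd)%:E.
    apply: (@le_trans _ _ (\int[P]_w (la `^ (- (r - 1)) / r * (parent n t j l w)%:R `^ r +
      la * (1 - r^-1) * ((S w)%:R * Wb w))%:E)).
      apply: expectation_le.
      + exact: mnat.
      + exact: (dmeas_comp (fun x => la `^ (- (r - 1)) / r * x.1%:R `^ r + la * (1 - r^-1) * (x.2%:R *
        (minn x.2 K)%:R `^ (r - 1)) : R)%R (dmeas_pair (mpar j l) mS)).
      + by move=> w; rewrite mulr_ge0.
      + move=> w; apply: le_trans (young_powR r_gt1 la0 (ler0n _ _) (ler0n _ _)) _.
        by rewrite mulrAC lerD2l ler_wpM2l// mulr_ge0 ?subr_ge0// ltW.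
    have -> : (la * bd = la `^ (- (r - 1)) / r * (z * u l `^ r) + la * (1 - r^-1) * y)%R.
      rewrite /bd mulrDr; congr (_ + _)%R; last by rewrite mulrA.
      rewrite [RHS](_ : _ = z / r * (la `^ (- (r - 1)) * u l `^ r))%R; last by ring.
      by rewrite laE; ring.
    apply: expectation_lin_le => //.
    - exact: (dmeas_comp (fun x => x%:R `^ r : R)%R (mpar j l)).
    - by rewrite mulr_ge0 ?powR_ge0// invr_ge0 ltW.
    - by rewrite mulr_ge0 ?subr_ge0// ltW.
    - exact: IH.
  rewrite -/la -mulrA.
  have -> : \int[P]_w ((parent n t j l w)%:R * ((1 + e) * A j i l * Wb w + C * mr))%:E =
    \int[P]_w ((1 + e) * A j i l * ((parent n t j l w)%:R * Wb w) + C * mr * (parent n t j l w)%:R)%:E.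
    by apply: eq_integral => w _; congr EFin; ring.
  apply: expectation_lin_le => //.
  - exact: mnat.
  - exact: dmeas_comp.
  - by move=> w; rewrite mulr_ge0.
  - by rewrite mulr_ge0 ?addr_ge0 ?A_ge0.
  - by rewrite mulr_ge0.
  - exact: picard_mean_le.
apply: (@le_trans _ _ (\sum_(j < q) \sum_(l < p)
   ((1 + e) * A j i l * (u l / u i) * bd + C * mr * (2 * m * u l))%:E)).
  by apply: lee_sum => j _; apply: lee_sum => l _.
under eq_bigr do rewrite sumEFin; rewrite sumEFin lee_fin.
under eq_bigr do rewrite big_split/=; rewrite big_split/= -/bd; apply: lerD.
  (* Summed against the coefficients of the [A j], the weights [u l / u i] give at most [k]. *)
  rewrite [leLHS](_ : _ = ((1 + e) * bd / u i * \sum_l (\sum_(j < q) A j) i l * u l)%R); last first.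
    rewrite exchange_big/= mulr_sumr; apply: eq_bigr => l _.
    rewrite summxE mulr_suml mulr_sumr; apply: eq_bigr => j _; ring.
  rewrite [leRHS](_ : _ = (1 + e) * bd / u i * (k * u i))%R; last first.
    by field; rewrite gt_eqF.
  apply: ler_wpM2l; first by rewrite divr_ge0 ?(ltW (u_gt0 i))// mulr_ge0// addr_ge0.
  exact: le_trans (Au_le i) (uk i).
rewrite sumr_const card_ord -mulr_sumr -mulr_sumr.
by rewrite -[X in (X <= _)%R]mulr_natl; lra.
Qed.

Lemma picard_moment_le : exists2 c : R, (0 <= c)%R &
  forall n t i, \int[P]_w ((XP n t w i ord0)%:R `^ r)%:E <= (c * u i `^ r)%:E.
Proof.
have [k [k0 k1 uk]] := contraction_factor.
have r0 : (0 < r)%R := lt_trans ltr01 r_gt1.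
(* Small enough for [th = (1 + e) * k] to stay below 1; [a] is then chosen with [2 * a = 1 - th]. *)
pose e := ((1 - k) / 2)%R.
have e0 : (0 < e)%R by rewrite /e; lra.
pose th := ((1 + e) * k)%R.
have th1 : (th < 1)%R by rewrite /th /e; nra.
have th0 : (0 <= th)%R by rewrite /th mulr_ge0//; lra.
have [C C0 HC] := powR_add_le r1_gt0 e0.
pose a := ((1 - th) / 2)%R.
have a0 : (0 < a)%R by rewrite /a; lra.
pose B := (a `^ (- (r - 1)) * mr + C * mr * (2 * m) * (q%:R * \sum_l u l))%R.
(* Chosen so that [B] is at most [a] times c u_i^r, whatever [n] and [K]. *)
pose c := (`|B| / a)%R.
have c0 : (0 <= c)%R by rewrite divr_ge0// ltW.
exists c => // n; elim: n => [|n IH] t i.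
  rewrite (eq_integral (cst 0)); last first.
    by move=> w _; rewrite mxE powR0// gt_eqF.
  by rewrite integral0 lee_fin mulr_ge0// powR_ge0.
have mS : dmeas (child n t i) by apply: dmeas_coef; exact: (dmeas_XP n.+1).
(* This removes the truncation: the bound holds for every [K], and the truncation is inactive at a
   point once [K] reaches the value of [child]. *)
apply: (@monotone_expectation_le _ _ _ _
  (fun K w => (child n t i w)%:R * (minn (child n t i w) K)%:R `^ (r - 1))%R) => //.
- move=> K; exact: (dmeas_comp (fun x => x%:R * (minn x K)%:R `^ (r - 1) : R)%R mS).
- move=> w K K' KK'; rewrite ler_wpM2l//.
  by apply: ge0_ler_powR; rewrite ?nnegrE ?(ltW r1_gt0)// ler_nat; lia.
- move=> K.
  have [y -> [y0]] := @truncated_moment_le k e C a c n t i K (ltW e0) C0 a0 c0 uk HC IH.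
  rewrite lee_fin -/th => Hy.
  have u1 : (1 <= u i `^ r)%R by rewrite -(powRr0 (u i)) ler_powR// ltW.
  pose z := (c * u i `^ r)%R; rewrite -/z.
  have Bz : (B <= z * a)%R.
    apply: le_trans (ler_norm B) _; rewrite /z mulrAC /c divfK ?gt_eqF//.
    by rewrite ler_peMr.
  (* As [1 - a - th = a], collecting the terms in [y] leaves the same factor [a + th / r] on both
     sides. *)
  have H : (y * (a + th / r) <= z * (a + th / r))%R.
    have aE : a = ((1 - th) / 2)%R by [].
    move: Hy Bz; rewrite /B -/z; set t1 := (a `^ _ * mr)%R; set t2 := (C * mr * _ * _)%R.
    rewrite aE; lra.
  rewrite ler_pM2r in H => //.
  by rewrite ltr_wpDr// divr_ge0// ltW.
- exact: (dmeas_comp (fun x => x%:R `^ r : R)%R mS).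
- by move=> w; exists (child n t i w); rewrite minnn mulr_powRB1.
Qed.

End moments.

End model.

(** * Existence, uniqueness and moments of the stationary solution *)

Lemma powR_norm1_le (R : realType) (p : nat) (x : 'cV[nat]_p) (r : R) : 1 < r ->
  (norm1 x)%:R `^ r <= p%:R `^ r * \sum_(i < p) (x i ord0)%:R `^ r.
Proof.
move=> r1; have r0 : 0 < r by lra.
case: p x => [|p] x; first by rewrite /norm1 big_ord0 powR0 ?gt_eqF// big_ord0 mulr0.
(* The norm is at most its number of coordinates times the largest one, whose power is one of the
   summands. *)
have [i _ xi] := @arg_maxnP 'I_p.+1 ord0 xpredT (fun i => x i ord0) isT.
apply: (@le_trans _ _ ((p.+1%:R * (x i ord0)%:R) `^ r)).
  apply: ge0_ler_powR; rewrite ?nnegrE ?ler0n ?mulr_ge0 ?(ltW r0)//.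
  rewrite -natrM ler_nat /norm1 -[X in (_ <= X * _)%N]card_ord -sum_nat_const.
  by apply: leq_sum => k _; exact: xi.
rewrite powRM// ler_wpM2l ?powR_ge0// (bigD1 i)//= lerDl.
by apply: sumr_ge0 => k _; exact: powR_ge0.
Qed.

Lemma RV_dmeas d (T : measurableType d) (R : realType) (P : probability T R) d'
    (V : measurableType d') (X : {RV P >-> V}) :
  (forall B : set V, measurable B) -> dmeas X.
Proof.
by move=> mV B; rewrite -[X in measurable X]setTI; apply: measurable_funP => //; exact: mV.
Qed.

Theorem theorem3 (d : measure_display) (T : measurableType d) (R : realType)
    (P : probability T R) (p q : nat) (hp : (0 < p)%N) (hq : (0 < q)%N)
    (U : int -> {RV P >-> 'cV[nat]_p})
    (Y : int -> int -> 'I_q -> 'I_p -> 'I_p -> {RV P >-> nat})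
    (A : 'I_q -> 'M[R]_p)
    (U_indep : mutually_independent P (fun t => sigma_of (U t)))
    (U_law : forall t, distribution P (U t) = distribution P (U 0))
    (U_int : forall t, integrable_vec P (U t))
    (Y_indep : mutually_independent P
       (fun k : int * int * 'I_q * 'I_p * 'I_p =>
          let: (s, t, j, i, l) := k in sigma_of (Y s t j i l)))
    (Y_law : forall s t j i l,
       distribution P (Y s t j i l) = distribution P (Y 0 0 j i l))
    (Y_int : forall s t j i l,
       P.-integrable [set: T] (fun w => ((Y s t j i l w)%:R : R)%:E))
    (Y_mean : forall s t j i l,
       'E_P[fun w => (Y s t j i l w)%:R]%E = (A j i l)%:E)
    (UY_indep : independent2 P
       <<s \bigcup_(t in [set: int]) sigma_of (U t) >>
       <<s \bigcup_(k in [set: int * int * 'I_q * 'I_p * 'I_p])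
             (let: (s, t, j, i, l) := k in sigma_of (Y s t j i l)) >>)
    (hrho : spectral_radius (\sum_(j < q) A j) < 1) :
  exists X : int -> T -> 'cV[nat]_p,
    [/\ good_solution P U Y X,
        (forall X' : int -> T -> 'cV[nat]_p, good_solution P U Y X' ->
           forall t, {ae P, forall w, X' t w = X t w})
      & forall r : R, 1 < r ->
          (forall j i l, finite_moment P r (Y 0 0 j i l)) ->
          finite_moment P r (fun w => norm1 (U 0 w)) ->
          finite_moment P r (fun w => norm1 (X 0 w))].
Proof.
have mU t : dmeas (U t) by exact: RV_dmeas.
have mY s t j i l : dmeas (Y s t j i l) by exact: RV_dmeas.
have PU t B : P (U t @^-1` B) = P (U 0 @^-1` B).
  exact: (congr1 (fun f => f B) (U_law t)).
have PY s t j i l B : P (Y s t j i l @^-1` B) = P (Y 0 0 j i l @^-1` B).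
  exact: (congr1 (fun f => f B) (Y_law s t j i l)).
pose Uf t := U t : T -> 'cV[nat]_p.
pose Yf s t j i l := Y s t j i l : T -> nat.
have Ymean s t j i l : (\int[P]_w ((Yf s t j i l w)%:R : R)%:E = (A j i l)%:E)%E.
  by have := Y_mean s t j i l; rewrite unlock.
(* The two independent families [U] and [Y] merge into the single independent family [noise]. *)
have indep (J : {fset noise_index p q}) (B : noise_index p q -> set nat) :
    P (cylinder (noise Uf Yf) J B) = (\prod_(i <- J) P (noise Uf Yf i @^-1` B i))%E.
  apply: (mutually_independent_sum U_indep Y_indep UY_indep) => -[t|[[[[s t] j] i] l]] _.
    by exists (choice.pickle @^-1` B (inl t)) => //; rewrite setTI.
  by exists (B (inr (s, t, j, i, l))) => //; rewrite setTI.
have [|u [u1 Au]] := spectral_radius_lt1_supersolution _ hrho.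
  by move=> i l; rewrite summxE sumr_ge0// => j _; exact: (A_ge0 Ymean).
have mnorm (x : T -> 'cV[nat]_p) : dmeas x -> dmeas (fun w => norm1 (x w)).
  exact: (dmeas_map (@norm1 p)).
have norm1_ge (x : 'cV[nat]_p) i : (x i ord0 <= norm1 x)%N.
  by rewrite /norm1 (bigD1 i)//= leq_addr.
have PN t n : P ((fun w => norm1 (U t w)) @^-1` [set n]) =
    P ((fun w => norm1 (U 0 w)) @^-1` [set n]).
  exact: (PU t ((@norm1 p) @^-1` [set n])).
have vec_fin (x : T -> 'cV[nat]_p) : integrable_vec P x ->
    exists m : R, (\int[P]_w ((norm1 (x w))%:R : R)%:E = m%:E)%E.
  move=> ix; exists (fine (\int[P]_w ((norm1 (x w))%:R : R)%:E)%E).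
  by rewrite fineK//; exact: integrable_fin_num.
have [m Em] := vec_fin _ (U_int 0).
(* All coordinates and all times share the bound [m], the mean of the norm of [U 0]. *)
have Um t i : (\int[P]_w ((Uf t w i ord0)%:R : R)%:E <= m%:E)%E.
  rewrite -Em -(expectation_eq_law (h := fun n => n%:R) (mnorm _ (mU t)) (mnorm _ (mU 0)) (PN t))//.
  apply: expectation_le.
  - exact: (dmeas_comp (fun n => n%:R : R) (dmeas_coef i (mU t))).
  - exact: (dmeas_comp (fun n => n%:R : R) (mnorm _ (mU t))).
  - by [].
  - by move=> w; rewrite ler_nat.
pose X t w := picard_lim (Uf ^~ w) (fun s t j i l => Yf s t j i l w) t.
have mX t : dmeas (X t) by exact: dmeas_XL.
have Xmean t i : (\int[P]_w ((X t w i ord0)%:R : R)%:E <= (2 * m * u i)%:E)%E.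
  exact: (XL_mean_le (A := A)).
have gX : good_solution P U Y X.
  split.
  - by move=> t; exact: (XL_solution (A := A) mU mY indep Ymean u1 Au Um t).
  - move=> n t h B; apply: (XL_stationary mU mY indep) => h' k B'.
    case: k => [t'|[[[[s' t'] j'] i'] l']] /=.
      by rewrite (PU (t' + h') (choice.pickle @^-1` B')) (PU t' (choice.pickle @^-1` B')).
    by rewrite (PY s' (t' + h')) (PY s' t').
  - move=> t; apply: dmeas_measurable_fun.
    apply: (@dmeas_picard_lim _ _ _ _ _ _ t) => //.
      move=> t' t't B; apply: sub_sigma_algebra; exists t' => //; left.
      by exists B => //; rewrite setTI.
    move=> s' t' j' i' l' t't B; apply: sub_sigma_algebra; exists t' => //; right.
    by exists (s', j', i', l') => //; exists B => //; rewrite setTI.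
  - move=> t; apply/integrableP; split.
      by apply/measurable_EFinP; exact: (dmeas_comp (fun n => n%:R : R) (mnorm _ (mX t))).
    rewrite (eq_integral (fun w => ((norm1 (X t w))%:R : R)%:E)); last first.
      by move=> w _; rewrite gee0_abs// lee_fin.
    rewrite expectation_sum; last by move=> i; exact: dmeas_coef.
    apply: (@le_lt_trans _ _ (\sum_(i < p) (2 * m * u i)%:E)%E).
      by apply: lee_sum => i _; exact: Xmean.
    by rewrite sumEFin ltry.
exists X; split => //.
- move=> X' [solX' statX' naX' intX'] t.
  have [m' Em'] := vec_fin _ (intX' 0).
  (* The past up to [t'] is generated by noise of times strictly before [t0]. *)
  have mX'b t0 t' : t' < t0 -> @dmeas _ (g_sigma_algebraType
      (coord_sets (noise Uf Yf) (before t0))) _ (X' t').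
    move=> t't B; have := naX' t' measurableT B I; rewrite setTI.
    apply: smallest_sub; first exact: smallest_sigma_algebra.
    move=> _ [s st' [[B' _ <-]|[[[[s' j'] i'] l'] _ [B' _ <-]]]]; rewrite setTI.
      by apply: (dmeas_U (D := before t0)); exact: le_lt_trans t't.
    by apply: (dmeas_Y (D := before t0)); exact: le_lt_trans t't.
  have mX' t' : dmeas (X' t').
    by apply: (dmeas_coarse mU mY (mX'b (t' + 1) t' _)); rewrite ltzD1.
  (* Stationarity, used for a single time, makes the mean of the norm constant. *)
  have X'mean t' : (\int[P]_w ((norm1 (X' t' w))%:R : R)%:E = m'%:E)%E.
    rewrite -Em' (expectation_eq_law (h := fun n => n%:R) (mnorm _ (mX' t')) (mnorm _ (mX' 0)))// => n.
    have := statX' 1%N (fun=> 0) t' [set f | norm1 (f ord0) = n].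
    by rewrite add0r.
  (* The bound has to be common to all times and coordinates, hence the sum over [i]; the factors 1
     match the form of [expectation_lin_le]. *)
  apply: (@solution_unique _ _ _ P p q Uf Yf A mU mY indep Ymean u u1 Au
     X' X (1 * m' + 1 * \sum_i `|2 * m * u i|)) => //.
  + by move=> t0 t' t't0; exact: dmeas_before_picard_lim.
  + by move=> t'; exact: (XL_solution (A := A) mU mY indep Ymean u1 Au Um t').
  + move=> t' i; apply: le_trans (expectation_lin_le (f := fun w => (norm1 (X' t' w))%:R)
      (g := fun w => (X t' w i ord0)%:R) (c := m') (e := \sum_i `|2 * m * u i|)
      _ _ _ _ ler01 ler01 _ _) => //.
    * apply: expectation_le => //.
      - exact: (dmeas_comp (fun x => (ndist x.1 x.2)%:R : R)
          (dmeas_pair (dmeas_coef i (mX' t')) (dmeas_coef i (mX t')))).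
      - exact: (dmeas_comp (fun x => 1 * x.1%:R + 1 * x.2%:R : R)
          (dmeas_pair (mnorm _ (mX' t')) (dmeas_coef i (mX t')))).
      - move=> w; rewrite !mul1r -natrD ler_nat.
        by have := norm1_ge (X' t' w) i; rewrite /ndist; lia.
    * exact: (dmeas_comp (fun n => n%:R : R) (mnorm _ (mX' t'))).
    * exact: (dmeas_comp (fun n => n%:R : R) (dmeas_coef i (mX t'))).
    * by rewrite X'mean.
    * apply: le_trans (Xmean t' i) _; rewrite lee_fin.
      by rewrite (bigD1 i)//= (le_trans (ler_norm _))// lerDl sumr_ge0.
- move=> r r1 YM UM; have r0 : 0 < r := lt_trans ltr01 r1.
  have fin (N : T -> nat) : finite_moment P r N ->
      (\int[P]_w ((N w)%:R `^ r)%:E)%E \is a fin_num.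
    rewrite /finite_moment unlock => Noo; rewrite ge0_fin_numE//.
    by apply: integral_ge0 => w _; rewrite lee_fin powR_ge0.
  pose mY0 (k : 'I_q * 'I_p * 'I_p) := fine (\int[P]_w ((Y 0 0 k.1.1 k.1.2 k.2 w)%:R `^ r)%:E)%E.
  pose mU0 := fine (\int[P]_w ((norm1 (U 0 w))%:R `^ r)%:E)%E.
  have mY0_ge0 k : 0 <= mY0 k.
    by apply/fine_ge0/integral_ge0 => w _; rewrite lee_fin powR_ge0.
  have mU0_ge0 : 0 <= mU0.
    by apply/fine_ge0/integral_ge0 => w _; rewrite lee_fin powR_ge0.
  (* One constant for all the moments: by equality of the laws only finitely many occur, and each is
     at most their sum. *)
  pose mr := \sum_k mY0 k + mU0.
  have mr0 : 0 <= mr by rewrite addr_ge0// sumr_ge0.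
  have YMr s t j i l : (\int[P]_w ((Yf s t j i l w)%:R `^ r)%:E <= mr%:E)%E.
    rewrite (expectation_eq_law (h := fun n => n%:R `^ r) (mY s t j i l) (mY 0 0 j i l))//.
    rewrite -(fineK (fin _ (YM j i l))) lee_fin /mr (bigD1 (j, i, l))//= -addrA lerDl.
    by rewrite addr_ge0// sumr_ge0.
  have UMr t i : (\int[P]_w ((Uf t w i ord0)%:R `^ r)%:E <= mr%:E)%E.
    apply: (@le_trans _ _ mU0%:E); last by rewrite lee_fin /mr lerDr sumr_ge0.
    rewrite /mU0 fineK; last exact: fin.
    rewrite -(expectation_eq_law (h := fun n => n%:R `^ r)
      (mnorm _ (mU t)) (mnorm _ (mU 0)) (PN t))//.
    apply: expectation_le.
    + exact: (dmeas_comp (fun n => n%:R `^ r : R) (dmeas_coef i (mU t))).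
    + exact: (dmeas_comp (fun n => n%:R `^ r : R) (mnorm _ (mU t))).
    + by [].
    + by move=> w; apply: ge0_ler_powR; rewrite ?nnegrE ?(ltW r0)// ler_nat.
  have [c c0 Hc] := picard_moment_le mU mY indep Ymean u1 Au Um r1 mr0 YMr UMr.
  have Xr i : (\int[P]_w ((X 0 w i ord0)%:R `^ r)%:E <= (c * u i `^ r)%:E)%E.
    apply: (XL_expectation_le mU mY (h := fun n => n%:R `^ r)) => // k n kn.
    by apply: ge0_ler_powR; rewrite ?nnegrE ?(ltW r0)// ler_nat.
  rewrite /finite_moment unlock.
  have mXr i : measurable_fun setT (fun w => (X 0 w i ord0)%:R `^ r : R).
    exact: (dmeas_comp (fun n => n%:R `^ r : R) (dmeas_coef i (mX 0))).
  apply: (@le_lt_trans _ _ (\int[P]_w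
      (p%:R `^ r * \sum_(i < p) (X 0 w i ord0)%:R `^ r)%:E)%E).
    apply: expectation_le => [| |w|w]; last exact: powR_norm1_le.
    + exact: (dmeas_comp (fun n => n%:R `^ r : R) (mnorm _ (mX 0))).
    + exact: (dmeas_comp (fun v : 'cV[nat]_p => p%:R `^ r * \sum_(i < p) (v i ord0)%:R `^ r : R) (mX 0)).
    + exact: powR_ge0.
  under eq_integral do rewrite EFinM -sumEFin.
  have msum : measurable_fun setT (fun w => \sum_(i < p) ((X 0 w i ord0)%:R `^ r : R)%:E)%E.
    by apply: emeasurable_sum => i; exact/measurable_EFinP.
  rewrite ge0_integralZl_EFin ?powR_ge0//; last first.
    by move=> w _; apply: sume_ge0 => i _; rewrite lee_fin powR_ge0.
  rewrite ge0_integral_sum//; last by move=> i; exact/measurable_EFinP.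
  apply: (@le_lt_trans _ _ ((p%:R `^ r)%:E * \sum_(i < p) (c * u i `^ r)%:E)%E).
    by rewrite lee_wpmul2l ?lee_fin ?powR_ge0//; apply: lee_sum => i _; exact: Xr.
  by rewrite sumEFin -EFinM ltry.
Qed.
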